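(* Let $\Omega \subseteq \mathbb{C}$ be a connected set that is either compact or open, let $\mathcal{A}(\Omega)$ be the ring of functions analytic on $\Omega$, and let $Q(z) \in \mathcal{A}(\Omega)^{n\times p}$. The columns of $Q(z)$ form an invertible basis for the $\mathcal{A}(\Omega)$-module they span if and only if $Q(\lambda) \in \mathbb{C}^{n \times p}$ has full column rank for all $\lambda \in \Omega$.
   Context: $\Omega$ is nonempty. When $\Omega$ is compact, a function analytic on $\Omega$ is a function analytic in some open neighbourhood of $\Omega$, two such functions being identified if they agree on a neighbourhood of $\Omega$. The ring $\mathcal{A}(\Omega)$ is an elementary divisor domain: every matrix over it has a Smith form. Invertible basis: for a commutative ring $R$ and a free $R$-module $M \subseteq R^n$ with basis $\mathcal{B}$ (a linearly independent set of generators over $R$), $\mathcal{B}$ is an invertible basis if there is a matrix $A \in R^{n\times p}$ whose columns are the elements of $\mathcal{B}$ and which is left invertible over $R$, i.e., there exists $L \in R^{p\times n}$ with $LA = I_p$. Here $R=\mathcal{A}(\Omega)$, and the columns of $Q(z)$ are regarded as a family of $p$ vectors (so a matrix with repeated columns does not have columns forming a basis). *)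

(* Defs.v *)
From HB Require Import structures.
From mathcomp Require Import all_boot all_order all_algebra.
From mathcomp Require Import perm ring_quotient complex.
From mathcomp Require Import ring.
From mathcomp Require Import all_classical all_reals all_analysis.

Set Implicit Arguments.
Unset Strict Implicit.
Unset Printing Implicit Defensive.

Import Order.TTheory GRing.Theory Num.Theory.
Import numFieldNormedType.Exports.

Local Open Scope quotient_scope.
Local Open Scope classical_set_scope.
Local Open Scope ring_scope.
Local Open Scope complex_scope.

(* The library only puts a topology on the alias R[i]^o of R[i]. *)
#[warnings="-redundant-canonical-projection"]
HB.instance Definition _ (R : realType) :=
  PseudoPointedMetric.copy R[i] R[i]^o.
#[warnings="-redundant-canonical-projection"]
HB.instance Definition _ (R : realType) := NormedModule.copy R[i] R[i]^o.

Definition analytic_at (K : numFieldType) (f : K -> K) (z : K) :=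
  exists a : nat -> K,
    \forall w \near z, series (fun k => a k * (w - z) ^+ k) @ \oo --> f w.

Section AnalyticAt.
Context {K : numFieldType}.
Implicit Types (f g : K -> K) (z c : K).

Lemma analytic_at_cst c z : analytic_at (cst c) z.
Proof.
exists (fun k => if k is 0 then c else 0).
near=> w; apply: (@cvg_near_cst _ _ c); near=> n.
have -> : n = n.-1.+1 by rewrite prednK//; near: n; exact: nbhs_infty_gt.
rewrite /series/= big_nat_recl//= expr0 mulr1 big1_seq ?addr0//.
by move=> i _; rewrite mul0r.
Unshelve. all: by end_near. Qed.

Lemma analytic_atD f g z :
  analytic_at f z -> analytic_at g z -> analytic_at (f + g) z.
Proof.
move=> [a fa] [b gb]; exists (fun k => a k + b k).
near=> w.
have -> : (fun k => (a k + b k) * (w - z) ^+ k) =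
    (fun k => a k * (w - z) ^+ k) + (fun k => b k * (w - z) ^+ k).
  by apply/funext => k; rewrite mulrDl.
by rewrite seriesD; apply: cvgD; [near: w|near: w].
Unshelve. all: by end_near. Qed.

Lemma analytic_atN f z : analytic_at f z -> analytic_at (- f) z.
Proof.
move=> [a fa]; exists (fun k => - a k); near=> w.
have -> : (fun k => - a k * (w - z) ^+ k) = - (fun k => a k * (w - z) ^+ k).
  by apply/funext => k; rewrite mulNr.
by rewrite seriesN; apply: cvgN; near: w.
Unshelve. all: by end_near. Qed.

Lemma pseries_coef_bound (a : nat -> K) (h l : K) :
  series (fun k => a k * h ^+ k) @ \oo --> l ->
  exists2 M, 0 <= M & forall k, `|a k| * `|h| ^+ k <= M.
Proof.
move=> al.
have /cvg_series_cvg_0 a0 : cvgn (series (fun k => a k * h ^+ k)).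
  by apply/cvg_ex; exists l.
have /cvg_seq_bounded/pinfty_ex_gt0[M M0 /= aM] :
  cvgn (fun k => a k * h ^+ k) by apply/cvg_ex; exists 0.
by exists M; [exact: ltW|move=> k; rewrite -normrX -normrM; exact: aM].
Qed.

Lemma sum_triangle (F : nat -> nat -> K) n :
  \sum_(0 <= k < n) \sum_(0 <= i < k.+1) F i (k - i)%N =
  \sum_(0 <= i < n) \sum_(0 <= j < n | (i + j < n)%N) F i j.
Proof.
have -> : \sum_(0 <= k < n) \sum_(0 <= i < k.+1) F i (k - i)%N =
    \sum_(0 <= k < n) \sum_(0 <= i < n | (i <= k)%N) F i (k - i)%N.
  by apply: eq_big_nat => k kn; rewrite (big_nat_widen _ _ n).
rewrite (exchange_big_dep_nat xpredT)//=; apply: eq_big_nat => i /andP[_ iN].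
rewrite -(@big_nat_widenl _ _ _ i 0 n xpredT)//.
rewrite -{1}[ i]add0n big_addn (big_nat_widen _ (n - i) n) ?leq_subr//=.
by apply: eq_big => [j|j _]; rewrite ?addnK// ltn_subRL.
Qed.

Lemma cauchy_product_bound (a b : nat -> K) (r h M N : K) n :
  0 <= M -> 0 <= N ->
  (forall k, `|a k| * r ^+ k <= M) -> (forall k, `|b k| * r ^+ k <= N) ->
  0 <= r -> `|h| <= r / 8 ->
  `|series (fun k => a k * h ^+ k) n * series (fun k => b k * h ^+ k) n -
    series (fun k => (\sum_(0 <= i < k.+1) a i * b (k - i)%N) * h ^+ k) n|
  <= M * N * 2^-1 ^+ n.
Proof.
move=> M0 N0 aM bN r0 hr.
have term (c : nat -> K) P : 0 <= P -> (forall k, `|c k| * r ^+ k <= P) ->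
    forall k, `|c k * h ^+ k| <= P * 8^-1 ^+ k.
  move=> P0 cP k; rewrite normrM normrX.
  apply: (@le_trans _ _ (`|c k| * (r / 8) ^+ k)).
    by apply: ler_wpM2l => //; apply: lerXn2r; rewrite ?nnegrE// divr_ge0.
  by rewrite exprMn mulrA; apply: ler_wpM2r => //; rewrite exprn_ge0// invr_ge0.
pose F i j := a i * h ^+ i * (b j * h ^+ j).
have -> : series (fun k => (\sum_(0 <= i < k.+1) a i * b (k - i)%N) * h ^+ k) n
   = \sum_(0 <= i < n) \sum_(0 <= j < n | (i + j < n)%N) F i j.
  rewrite -sum_triangle /series/=; apply: eq_bigr => k _.
  rewrite mulr_suml; apply: eq_big_nat => i /andP[_ ik].
  by rewrite /F mulrACA -exprD subnKC.
rewrite /series/= mulr_suml -sumrB.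
have -> : \sum_(0 <= i < n) (a i * h ^+ i * (\sum_(0 <= k < n) b k * h ^+ k) -
      \sum_(0 <= j < n | (i + j < n)%N) F i j) =
    \sum_(0 <= i < n) \sum_(0 <= j < n | ~~ (i + j < n)%N) F i j.
  apply: eq_bigr => i _; rewrite mulr_sumr.
  by rewrite (bigID (fun j => i + j < n)%N)/= /F addrAC subrr add0r.
have h8 : (0 : K) <= 8^-1 by rewrite invr_ge0.
have Fle i j : ~~ (i + j < n)%N -> `|F i j| <= M * N * 8^-1 ^+ n.
  rewrite -leqNgt => nij; rewrite normrM.
  apply: le_trans (ler_pM _ _ (term a M M0 aM i) (term b N N0 bN j)) _ => //.
  rewrite mulrACA -exprD; apply: ler_wpM2l; first exact: mulr_ge0.
  by apply: ler_wiXn2l => //; rewrite invf_le1 ?ler1n.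
apply: le_trans (ler_norm_sum _ _ _) _.
apply: (@le_trans _ _ (\sum_(0 <= i < n) \sum_(0 <= j < n) M * N * 8^-1 ^+ n)).
  apply: ler_sum => i _; apply: le_trans (ler_norm_sum _ _ _) _.
  apply: (@le_trans _ _
    (\sum_(0 <= j < n | ~~ (i + j < n)%N) M * N * 8^-1 ^+ n)).
    by apply: ler_sum => j; exact: Fle.
  rewrite [leRHS](bigID (fun j => i + j < n)%N)/= lerDr.
  by apply: sumr_ge0 => j _; rewrite !mulr_ge0// exprn_ge0.
rewrite !sumr_const_nat subn0 -mulrnA -mulrnAr.
apply: ler_wpM2l; first exact: mulr_ge0.
rewrite -mulr_natl.
have -> : (2^-1 : K) ^+ n = (2 ^ n * 2 ^ n)%:R * 8^-1 ^+ n.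
  rewrite !natrM natrX -!exprMn; congr (_ ^+ n).
  by field.
apply: ler_wpM2r; first exact: exprn_ge0.
by rewrite ler_nat leq_mul// ltnW// ltn_expl.
Qed.

(* 2^-n --> 0 needs the archimedean property, which numFieldType lacks. *)
Lemma analytic_atM f g z : (GRing.exp (2^-1 : K) @ \oo --> (0 : K)) ->
  analytic_at f z -> analytic_at g z -> analytic_at (f * g) z.
Proof.
move=> half0 [a fa] [b gb].
exists (fun k => \sum_(0 <= i < k.+1) a i * b (k - i)%N).
have [e /= e0 eP] := (nbhs_ballP z _).1 (filterI fa gb).
have := eP (z + e / 2); rewrite /ball/= opprD addNKr normrN.
rewrite gtr0_norm; last by rewrite divr_gt0.
rewrite ltr_pdivrMr// mulr_natr mulr2n ltrDl e0.
move=> /(_ isT)[].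
rewrite [z + _]addrC addrK => /pseries_coef_bound[M M0 aM].
move=> /pseries_coef_bound[N N0 bN].
have e20 : 0 < e / 2 by rewrite divr_gt0.
have e80 : 0 < e / 2 / 8 by rewrite divr_gt0.
move: aM bN; rewrite gtr0_norm// => aM bN.
apply/nbhs_ballP; exists (e / 2 / 8) => //= w.
rewrite /ball/= distrC => wz.
have [] := eP w.
  rewrite /ball/= distrC (lt_trans wz)//.
  rewrite -mulrA -invfM gtr_pMr// invf_lt1// -?natrM ?ltr1n//.
move=> fw gw.
pose u := series (fun k => a k * (w - z) ^+ k) *
          series (fun k => b k * (w - z) ^+ k).
pose v := series (fun k => (\sum_(0 <= i < k.+1) a i * b (k - i)%N)
                           * (w - z) ^+ k).
have uv : (u - v) @ \oo --> (0 : K).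
  have MN0 : (fun n => M * N * 2^-1 ^+ n) @ \oo --> (0 : K).
    by rewrite -[X in _ --> X](mulr0 (M * N)); apply: cvgM half0; exact: cvg_cst.
  apply/cvgrPdist_lt => d d0; move/cvgrPdist_lt : MN0 => /(_ d d0).
  apply: filterS => n; rewrite !sub0r !normrN; apply: le_lt_trans.
  rewrite [leRHS]ger0_norm ?mulr_ge0// ?exprn_ge0 ?invr_ge0//.
  exact: cauchy_product_bound M0 N0 aM bN (ltW e20) (ltW wz).
rewrite -/v (_ : v = u - (u - v)); last by rewrite subKr.
by rewrite -[X in _ --> X]subr0; apply: cvgB uv; exact: cvgM fw gw.
Qed.

End AnalyticAt.
Lemma cvg_exp_half_complex (R : realType) :
  GRing.exp (2^-1 : R[i]) @ \oo --> (0 : R[i]).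
Proof.
apply/(@cvgrPdist_lt R[i] R[i]) => e e0.
have eE : e = (complex.Re e)%:C by rewrite RRe_real// ger0_real// ltW.
have re0 : 0 < complex.Re e by rewrite -ltcR -eE.
have : @GRing.exp R 2^-1 @ \oo --> 0.
  by apply: cvg_expr; rewrite ger0_norm ?invr_ge0// invf_lt1// ltr1n.
move/cvgrPdist_lt => /(_ _ re0); apply: filterS => n.
rewrite !sub0r !normrN !ger0_norm ?exprn_ge0 ?invr_ge0// -ltcR -eE.
by rewrite rmorphXn/= fmorphV rmorph_nat.
Qed.

Section AnalyticRing.
Context {R : realType}.
Variable Omega : set R[i].
Implicit Types f g : R[i] -> R[i].

Definition analytic_near : {pred R[i] -> R[i]} :=
  [pred f | `[< set_nbhs Omega [set z | analytic_at f z] >]].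

Lemma analytic_nearP f :
  reflect (exists U, [/\ open U, Omega `<=` U & forall z, U z -> analytic_at f z])
          (f \in analytic_near).
Proof. by apply: (iffP (asboolP _)) => /set_nbhsP. Qed.

Lemma analytic_near_subring : subring_closed analytic_near.
Proof.
split=> [|f g /asboolP fO /asboolP gO|f g /asboolP fO /asboolP gO];
    apply/asboolP.
- by apply: filterE => z; exact: (@analytic_at_cst R[i]).
- apply: filterS (filterI fO gO) => z [fz gz].
  by have /(@analytic_atD R[i] _ _ _ fz) := @analytic_atN R[i] _ _ gz.
- apply: filterS (filterI fO gO) => z [fz gz].
  by have := @analytic_atM R[i] _ _ _ (@cvg_exp_half_complex R) fz gz.
Qed.

HB.instance Definition _ :=
  GRing.isSubringClosed.Build _ analytic_near analytic_near_subring.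

Record analytic_fun := AnalyticFun {
  analytic_fun_val :> R[i] -> R[i];
  _ : analytic_fun_val \in analytic_near }.

HB.instance Definition _ := [isSub for analytic_fun_val].
HB.instance Definition _ := [Choice of analytic_fun by <:].
HB.instance Definition _ := [SubChoice_isSubComNzRing of analytic_fun by <:].

Definition null_near : {pred analytic_fun} :=
  [pred f : analytic_fun | `[< set_nbhs Omega [set z | f z = 0] >]].

Lemma null_near_zmod : zmod_closed null_near.
Proof.
split=> [|f g /asboolP fO /asboolP gO]; apply/asboolP.
  exact: filterE.
apply: filterS (filterI fO gO) => z /= [fz gz].
by transitivity (f z - g z) => //; rewrite fz gz subr0.
Qed.

HB.instance Definition _ :=
  GRing.isZmodClosed.Build _ null_near null_near_zmod.

(* Functions analytic in some open neighbourhood of Omega, identified when they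
   agree on a neighbourhood of Omega (analytic_nearP, analytic_germ_eq).  For
   open Omega these are the functions on Omega analytic at each point of Omega
   (analytic_near_open, analytic_germ_eq_open). *)
Definition analytic_ring := Quotient.quot null_near.

HB.instance Definition _ := GRing.Zmodule.on analytic_ring.
HB.instance Definition _ :=
  EqQuotient.copy analytic_ring (Quotient.quot null_near).

Definition analytic_germ (f : analytic_fun) : analytic_ring := \pi f.

Lemma analytic_germ_eq (f g : analytic_fun) :
  analytic_germ f = analytic_germ g <-> set_nbhs Omega [set z | f z = g z].
Proof.
have E : [set z | f z = g z] = [set z | (f - g : analytic_fun) z = 0].
  apply/seteqP; split => z /= fg; last exact/subr0_eq.
  by transitivity (f z - g z) => //; rewrite fg subrr.
rewrite E; split => [/eqmodP/asboolP//|fg]; exact/eqmodP/asboolP.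
Qed.

Lemma analytic_germK (x : analytic_ring) : analytic_germ (repr x) = x.
Proof. exact: reprK. Qed.

Lemma repr_analytic_germ (f : analytic_fun) :
  set_nbhs Omega [set z | repr (analytic_germ f) z = f z].
Proof. by apply/analytic_germ_eq; rewrite analytic_germK. Qed.

Definition analytic_mul (x y : analytic_ring) : analytic_ring :=
  analytic_germ (repr x * repr y).

Lemma analytic_mulE (f g : analytic_fun) :
  analytic_mul (analytic_germ f) (analytic_germ g) = analytic_germ (f * g).
Proof.
apply/analytic_germ_eq.
apply: filterS (filterI (repr_analytic_germ f) (repr_analytic_germ g)).
move=> z [/= fz gz].
transitivity (repr (analytic_germ f) z * repr (analytic_germ g) z) => //.
by rewrite fz gz.
Qed.

Lemma analytic_germD (f g : analytic_fun) :
  analytic_germ (f + g) = analytic_germ f + analytic_germ g.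
Proof. exact: raddfD. Qed.

Lemma analytic_mulA : associative analytic_mul.
Proof.
move=> x y z.
by rewrite -[x]analytic_germK -[y]analytic_germK -[z]analytic_germK
  !analytic_mulE mulrA.
Qed.

Lemma analytic_mulC : commutative analytic_mul.
Proof. by move=> x y; rewrite /analytic_mul mulrC. Qed.

Lemma analytic_mul1 : left_id (analytic_germ 1) analytic_mul.
Proof. by move=> x; rewrite -[x]analytic_germK analytic_mulE mul1r. Qed.

Lemma analytic_mulDl : left_distributive analytic_mul +%R.
Proof.
move=> x y z.
rewrite -[x]analytic_germK -[y]analytic_germK -[z]analytic_germK.
by rewrite -analytic_germD !analytic_mulE mulrDl analytic_germD.
Qed.

HB.instance Definition _ := GRing.Zmodule_isComPzRing.Build analytic_ring
  analytic_mulA analytic_mulC analytic_mul1 analytic_mulDl.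

Lemma analytic_germ_zmod_morphism : zmod_morphism analytic_germ.
Proof. by move=> f g; rewrite /analytic_germ raddfB. Qed.

Lemma analytic_germ_monoid_morphism : monoid_morphism analytic_germ.
Proof. by split=> // f g; rewrite -analytic_mulE. Qed.

HB.instance Definition _ := GRing.isZmodMorphism.Build
  analytic_fun analytic_ring analytic_germ analytic_germ_zmod_morphism.
HB.instance Definition _ := GRing.isMonoidMorphism.Build
  analytic_fun analytic_ring analytic_germ analytic_germ_monoid_morphism.

(* Only meaningful for z in Omega, see analytic_evalE. *)
Definition analytic_eval (z : R[i]) (x : analytic_ring) : R[i] := repr x z.

Lemma analytic_evalE (z : R[i]) (f : analytic_fun) :
  Omega z -> analytic_eval z (analytic_germ f) = f z.
Proof. by move=> Oz; exact: nbhs_singleton (repr_analytic_germ f Oz). Qed.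

Lemma analytic_near_open f : open Omega ->
  f \in analytic_near <-> forall z, Omega z -> analytic_at f z.
Proof.
move=> oO; split=> [/analytic_nearP[U [_ OU Uf]] z /OU/Uf//|fO].
by apply/analytic_nearP; exists Omega; split.
Qed.

Lemma analytic_germ_eq_open (f g : analytic_fun) : open Omega ->
  analytic_germ f = analytic_germ g <-> forall z, Omega z -> f z = g z.
Proof.
move=> oO; rewrite analytic_germ_eq set_nbhsP.
split=> [[U [_ OU Ufg]] z /OU/Ufg//|fg].
by exists Omega; split.
Qed.

End AnalyticRing.

Arguments analytic_eval {R Omega} z x.

Section InvertibleBasis.
Context {R : comPzRingType} {n p : nat}.
Implicit Types (M : set 'cV[R]_n) (b : 'I_p -> 'cV[R]_n).

Definition span_of b : set 'cV[R]_n :=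
  [set x | exists c : 'I_p -> R, x = \sum_i c i *: b i].

Definition linearly_independent b :=
  forall c : 'I_p -> R, \sum_i c i *: b i = 0 -> forall i, c i = 0.

Definition basis M b := linearly_independent b /\ span_of b = M.

Definition left_invertible (A : 'M[R]_(n, p)) :=
  exists L : 'M[R]_(p, n), L *m A = 1%:M.

(* The columns of A are the vectors of the family b, listed in any order. *)
Definition invertible_basis M b :=
  basis M b /\
  exists A : 'M[R]_(n, p),
    (exists s : 'S_p, forall j, col j A = b (s j)) /\ left_invertible A.

End InvertibleBasis.

(* Main.v *)
Require Import Defs.
From HB Require Import structures.
From mathcomp Require Import all_boot all_order all_algebra.
From mathcomp Require Import perm complex ring lra.
From mathcomp Require Import all_classical all_reals all_analysis.

Set Implicit Arguments.
Unset Strict Implicit.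
Unset Printing Implicit Defensive.

Import Order.TTheory GRing.Theory Num.Theory.
Import numFieldNormedType.Exports.

Local Open Scope classical_set_scope.
Local Open Scope ring_scope.
Local Open Scope complex_scope.

(** If [L *m Q = 1] then evaluating at a point of [Omega] shows that [Q] has
    full column rank there.  Conversely, if the rank is full on [Omega], the
    [p]-minors of [Q] have no common zero on some open [U] containing [Omega].
    Analytic functions [f_i] without common zeros on an open set generate the
    unit ideal: after splitting off the components where some of them vanish
    identically, one solves [sum g_i f_i = 1] by removing the poles of [1 / F],
    for one combination [F] of the [f_i] with isolated zeros, using functions
    with prescribed principal parts (Mittag-Leffler).  A relation
    [sum g_s det Q_s = 1] between the minors gives the left inverse
    [sum g_s (adj Q_s) S_s], where [S_s] selects the rows of [Q_s].
    Approximation takes place in the Wiener algebras of closed discs, where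
    power series are normed by the sum of the absolute values of their
    coefficients, so that Cauchy's formula is not needed. *)

(** * The complex norm and limits of sequences *)

Section ComplexNorm.
Context {R : realType}.
Local Notation C := R[i].
Implicit Types (x y z w : C) (e r : R).

(* The norm of R[i] in MathComp is R[i]-valued, and R[i] is only partially
   ordered. *)
Definition nrm x : R := Normc.normc x.

Lemma nrmE x : `|x| = (nrm x)%:C.
Proof. by []. Qed.

Lemma nrm_ge0 x : 0 <= nrm x.
Proof. by rewrite -ler0c -nrmE normr_ge0. Qed.

Lemma nrm0 : nrm 0 = 0.
Proof. exact: Normc.normc0. Qed.

Lemma nrm1 : nrm 1 = 1.
Proof. exact: Normc.normc1. Qed.

Lemma nrm_eq0 x : (nrm x == 0) = (x == 0).
Proof.
by apply/eqP/eqP => [/Normc.eq0_normc//|->]; exact: nrm0.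
Qed.

Lemma nrm_gt0 x : (0 < nrm x) = (x != 0).
Proof. by rewrite lt_def nrm_ge0 andbT nrm_eq0. Qed.

Lemma nrmN x : nrm (- x) = nrm x.
Proof. exact: normcN. Qed.

Lemma nrmB x y : nrm (x - y) = nrm (y - x).
Proof. by rewrite -nrmN opprB. Qed.

Lemma nrmD x y : nrm (x + y) <= nrm x + nrm y.
Proof. exact: le_normcD. Qed.

Lemma nrmDB x y z : nrm (x - z) <= nrm (x - y) + nrm (y - z).
Proof. by rewrite -[x - z](subrKA y) nrmD. Qed.

Lemma nrmM x y : nrm (x * y) = nrm x * nrm y.
Proof. exact: Normc.normcM. Qed.

Lemma nrmV x : nrm x^-1 = (nrm x)^-1.
Proof. exact: Normc.normcV. Qed.

Lemma nrmX x k : nrm (x ^+ k) = nrm x ^+ k.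
Proof. by elim: k => [|k IH]; rewrite ?expr0 ?nrm1// !exprS nrmM IH. Qed.

Lemma nrm_real r : 0 <= r -> nrm r%:C = r.
Proof. by move=> r0; rewrite /nrm/= expr0n/= addr0 sqrtr_sqr ger0_norm. Qed.

Lemma nrm_sum (I : Type) (s : seq I) (P : pred I) (F : I -> C) :
  nrm (\sum_(i <- s | P i) F i) <= \sum_(i <- s | P i) nrm (F i).
Proof.
elim/big_rec2 : _ => [|i y x _ yx]; first by rewrite nrm0.
by rewrite (le_trans (nrmD _ _))// lerD2l.
Qed.

Lemma normr_Re_le x : `|complex.Re x| <= nrm x.
Proof. by rewrite -lecR; exact: normc_ge_Re. Qed.

Lemma normr_Im_le x : `|complex.Im x| <= nrm x.
Proof.
case: x => a b /=; rewrite -sqrtr_sqr ler_wsqrtr// lerDr sqr_ge0//.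
Qed.

Lemma nrm_le_ReIm x : nrm x <= `|complex.Re x| + `|complex.Im x|.
Proof.
case: x => a b /=; rewrite -[leRHS]ger0_norm ?addr_ge0// -sqrtr_sqr.
rewrite ler_wsqrtr// sqrrD !real_normK ?num_real//.
by rewrite lerD2r lerDl mulrn_wge0// mulr_ge0.
Qed.

Lemma gt0_complex_Re (e : C) : 0 < e -> e = (complex.Re e)%:C /\ 0 < complex.Re e.
Proof.
move=> e0.
have eE : e = (complex.Re e)%:C by rewrite RRe_real// ger0_real// ltW.
by split => //; rewrite -ltcR -eE.
Qed.

Lemma near_nrmP (P : set C) z :
  (\forall w \near z, P w) <->
  exists2 r, 0 < r & forall w, nrm (w - z) <= r -> P w.
Proof.
split=> [/nbhs_ballP[e /= e0 eP]|[r r0 rP]].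
  have [eE e'0] := gt0_complex_Re e0; exists (complex.Re e / 2); first by rewrite divr_gt0.
  move=> w wz; apply: eP; rewrite /ball/= distrC nrmE eE ltcR.
  by rewrite (le_lt_trans wz)// ltr_pdivrMr// mulr_natr mulr2n ltrDl.
apply/nbhs_ballP; exists r%:C => /=; first by rewrite -[0]/(0%:C) ltcR.
by move=> w; rewrite /ball/= distrC nrmE ltcR => /ltW/rP.
Qed.

Lemma near_all (P : set C) z : (forall w, P w) -> \forall w \near z, P w.
Proof. by move=> Pw; apply/near_nrmP; exists 1. Qed.

(** Convergence with real, non-strict bounds; [cvg_tends] links it to the filter form in which
    [analytic_at] is stated. *)
Definition tends (u : nat -> C) (l : C) :=
  forall e, 0 < e -> exists N, forall n, (N <= n)%N -> nrm (u n - l) <= e.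

Lemma cvg_tends (u : nat -> C) (l : C) : u @ \oo --> l <-> tends u l.
Proof.
split=> [ul e e0|ul].
  have e0' : 0 < e%:C by rewrite -[0]/(0%:C) ltcR.
  have /cvgrPdist_lt /(_ _ e0')[N _ NP] := ul.
  exists N => n /NP/=; rewrite distrC nrmE ltcR; exact: ltW.
apply/(@cvgrPdist_lt C C) => e /gt0_complex_Re[eE e0].
have [|N NP] := ul (complex.Re e / 2); first by rewrite divr_gt0.
exists N => // n /= /NP nN; rewrite distrC nrmE eE ltcR.
by rewrite (le_lt_trans nN)// ltr_pdivrMr// mulr_natr mulr2n ltrDl.
Qed.

Lemma tends_eq (u v : nat -> C) (l : C) : u =1 v -> tends u l -> tends v l.
Proof. by move=> /funext ->. Qed.

Lemma tends_near_cst (u : nat -> C) (l : C) N :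
  (forall n, (N <= n)%N -> u n = l) -> tends u l.
Proof. by move=> ul e e0; exists N => n /ul ->; rewrite subrr nrm0 ltW. Qed.

Lemma tends_cst (c : C) : tends (fun=> c) c.
Proof. exact: (@tends_near_cst _ _ 0%N). Qed.

Lemma tendsD (u v : nat -> C) (a b : C) : tends u a -> tends v b ->
  tends (fun n => u n + v n) (a + b).
Proof.
move=> ua vb e e0; have e2 : 0 < e / 2 by rewrite divr_gt0.
have [N NP] := ua _ e2; have [M MP] := vb _ e2.
exists (maxn N M) => n; rewrite geq_max => /andP[/NP h1 /MP h2].
by rewrite opprD addrACA (le_trans (nrmD _ _))//; lra.
Qed.

Lemma tendsZ (c : C) (u : nat -> C) (a : C) : tends u a ->
  tends (fun n => c * u n) (c * a).
Proof.
move=> ua e e0.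
have c0 : 0 < nrm c + 1 by have := nrm_ge0 c; lra.
have [N NP] := ua (e / (nrm c + 1)) (divr_gt0 e0 c0).
exists N => n /NP h; rewrite -mulrBr nrmM.
move: h; rewrite ler_pdivlMr// mulrDr mulr1 mulrC; apply: le_trans.
by rewrite lerDl nrm_ge0.
Qed.

Lemma tends_sum (I : Type) (s : seq I) (u : nat -> I -> C) (l : I -> C) :
  (forall i, tends (fun n => u n i) (l i)) ->
  tends (fun n => \sum_(i <- s) u n i) (\sum_(i <- s) l i).
Proof.
move=> ul; elim: s => [|i s IH].
  rewrite big_nil; apply: (tends_eq _ (tends_cst 0)) => n.
  by rewrite big_nil.
rewrite big_cons; apply: (tends_eq _ (tendsD (ul i) IH)) => n.
by rewrite big_cons.
Qed.

Lemma tends_shift (u : nat -> C) (l : C) :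
  tends (fun n => u n.+1) l <-> tends u l.
Proof.
split=> ul e /ul[N NP]; last by exists N => n nN; exact: NP (leqW nN).
by exists N.+1 => -[//|n] /NP.
Qed.

Lemma tends_nrm_le (u : nat -> C) (l : C) e N :
  tends u l -> (forall n, (N <= n)%N -> nrm (u n) <= e) -> nrm l <= e.
Proof.
move=> ul ue; apply/ler_addgt0Pr => d d0.
have [M MP] := ul _ d0; pose n := maxn N M.
rewrite -[l](subrK (u n)) (le_trans (nrmD _ _))// addrC lerD//.
  by rewrite ue// leq_maxl.
by rewrite nrmB MP// leq_maxr.
Qed.

End ComplexNorm.

Arguments nrm {R} x : simpl never.

(** * Power series with absolutely summable coefficients *)

Section AbsoluteConvergence.
Context {R : realType}.
Local Notation C := R[i].
Implicit Types (u : nat -> C) (m : nat -> R) (M e r : R).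

(** [series m N] is taken within [e] of the supremum of the partial sums, which bounds every
    [series m n]. *)
Lemma nneg_series_tail m M : (forall k, 0 <= m k) ->
  (forall n, series m n <= M) -> forall e, 0 < e ->
  exists N, forall n, series m n - series m N <= e.
Proof.
move=> m0 mM e e0; pose A := range (series m).
have hA : has_sup A.
  by split; [exists (series m 0%N), 0%N|exists M => _ [n _ <-]].
have [_ [N _ <-] NP] := sup_adherent e0 hA; exists N => n.
have : series m n <= sup A by apply: ub_le_sup; [case: hA|exists n].
by rewrite lerBlDl; move: NP; lra.
Qed.

Lemma tends_nrm u (l : C) : tends u l ->
  (nrm (u n) @[n --> \oo] --> nrm l).
Proof.
move=> ul; apply/cvgrPdist_le => e /ul[N NP].
exists N => // n /= /NP; apply: le_trans; rewrite ler_norml.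
have := nrmDB l (u n) 0; have := nrmDB (u n) l 0.
rewrite !subr0 (nrmB l); lra.
Qed.

Lemma nrm_series_tail u m l N e : (forall k, nrm (u k) <= m k) ->
  tends (series u) l -> (forall n, series m n - series m N <= e) ->
  nrm (l - series u N) <= e.
Proof.
move=> um ul me; have uN := tendsD ul (tends_cst (- series u N)).
apply: (tends_nrm_le (N := N) uN) => n Nn.
apply: le_trans (me n); rewrite !sub_series_geq//.
by rewrite (le_trans (nrm_sum _ _ _))// ler_sum.
Qed.

Lemma nrm_series_le u m l M : (forall k, nrm (u k) <= m k) ->
  tends (series u) l -> (forall n, series m n <= M) -> nrm l <= M.
Proof.
move=> um ul mM; apply: (tends_nrm_le (N := 0) ul) => n _.
by apply: le_trans (mM n); rewrite (le_trans (nrm_sum _ _ _))// ler_sum.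
Qed.

(** Completeness is inherited from [R]: the real and imaginary parts converge absolutely by
    comparison. *)
Lemma abs_cvg_series u M :
  (forall n, series (fun k => nrm (u k)) n <= M) ->
  exists l, tends (series u) l.
Proof.
move=> uM.
have real_part (p : C -> R) : (forall x, `|p x| <= nrm x) ->
    cvgn (series (p \o u)).
  move=> px; apply: normed_cvg.
  apply: (@series_le_cvg _ _ (fun k => nrm (u k))) => [k|k|k|] //=.
    exact: nrm_ge0.
  apply: nondecreasing_is_cvgn; last by exists M => _ [n _ <-].
  by apply: nondecreasing_series => k *; exact: nrm_ge0.
have /cvg_ex[a /cvgrPdist_le ua] := real_part _ (@normr_Re_le R).
have /cvg_ex[b /cvgrPdist_le ub] := real_part _ (@normr_Im_le R).
exists (a +i* b); move=> e e0.
have e2 : 0 < e / 2 by rewrite divr_gt0.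
have [N1 _ N1P] := ua _ e2; have [N2 _ N2P] := ub _ e2.
exists (maxn N1 N2) => n; rewrite geq_max => /andP[/N1P/= h1 /N2P/= h2].
have sE : series u n = series (@complex.Re R \o u) n +i*
                       series (@complex.Im R \o u) n.
  rewrite /series/=; elim: n {h1 h2} => [|n IH]; first by rewrite !big_geq.
  by rewrite !big_nat_recr//= IH; case: (u n) => x y; simpc.
rewrite sE (le_trans (nrm_le_ReIm _))//=.
by rewrite -[(_ - a)]opprB -[(_ - b)]opprB !normrN; lra.
Qed.

End AbsoluteConvergence.

Section Wiener.
Context {R : realType}.
Local Notation C := R[i].
Implicit Types (f g : C -> C) (a : nat -> C) (z w : C) (r M : R).

Definition pser f z r M a :=
  (forall n, series (fun k => nrm (a k) * r ^+ k) n <= M) /\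
  forall w, nrm (w - z) <= r ->
    tends (series (fun k => a k * (w - z) ^+ k)) (f w).

(* Membership of f in the ball of radius M of the Wiener algebra of the closed
   disc: power series normed by the sum of |a_k| r^k.  Contrary to the sup
   norm, this norm needs no integral formula to control coefficients. *)
Definition wiener f z r M := exists a, pser f z r M a.

Lemma nrm_monomial_le z r a w k : nrm (w - z) <= r ->
  nrm (a k * (w - z) ^+ k) <= nrm (a k) * r ^+ k.
Proof.
by move=> wr; rewrite nrmM nrmX ler_wpM2l ?nrm_ge0// lerXn2r ?nnegrE ?nrm_ge0//
  (le_trans (nrm_ge0 _) wr).
Qed.

(** Stands in for Cauchy's estimates: one term of a nonnegative sum is at most the sum. *)
Lemma pser_coef f z r M a k : 0 <= r -> pser f z r M a ->
  nrm (a k) * r ^+ k <= M.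
Proof.
move=> r0 [aM _]; apply: le_trans (aM k.+1); rewrite /series/= big_nat_recr//=.
by rewrite lerDr sumr_ge0// => i _; rewrite mulr_ge0 ?nrm_ge0 ?exprn_ge0.
Qed.

Lemma wiener_ge0 f z r M : wiener f z r M -> 0 <= M.
Proof. by move=> [a [/(_ 0%N) + _]]; rewrite /series/= big_geq. Qed.

Lemma wiener_nrm f z r M w : wiener f z r M -> nrm (w - z) <= r ->
  nrm (f w) <= M.
Proof.
move=> [a [aM af]] wr; apply: nrm_series_le (af w wr) aM => k.
exact: nrm_monomial_le.
Qed.

Lemma wiener_ext f g z r M : (forall w, nrm (w - z) <= r -> f w = g w) ->
  wiener f z r M -> wiener g z r M.
Proof.
move=> fg [a [aM af]]; exists a; split=> // w wr; rewrite -fg//; exact: af.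
Qed.

Lemma wiener_le f z r M N : M <= N -> wiener f z r M -> wiener f z r N.
Proof.
by move=> MN [a [aM af]]; exists a; split => // n; rewrite (le_trans (aM n)).
Qed.

Lemma wiener_shrink f z r s M : 0 <= s -> s <= r ->
  wiener f z r M -> wiener f z s M.
Proof.
move=> s0 sr [a [aM af]]; exists a; split=> [n|w ws].
  apply: le_trans (aM n); apply: ler_sum => k _; rewrite ler_wpM2l ?nrm_ge0//.
  by rewrite lerXn2r// nnegrE// (le_trans s0).
by apply: af; rewrite (le_trans ws).
Qed.

Lemma series_single (V : zmodType) (v : nat -> V) m n : (m < n)%N ->
  (forall k, k != m -> v k = 0) -> series v n = v m.
Proof.
move=> mn v0; rewrite /series/= (bigD1_seq m) ?mem_index_iota ?iota_uniq//=.
by rewrite big1 ?addr0// => k /v0.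
Qed.

Lemma tends_series_single (v : nat -> C) m :
  (forall k, k != m -> v k = 0) -> tends (series v) (v m).
Proof.
move=> v0; by apply: (@tends_near_cst _ _ _ m.+1) => n mn; apply: series_single.
Qed.

Lemma wiener_monomial c m z r M : 0 <= r -> nrm c * r ^+ m <= M ->
  wiener (fun w => c * (w - z) ^+ m) z r M.
Proof.
move=> r0 cM; exists (fun k => if k == m then c else 0); split=> [n|w wr].
  have [mn|nm] := ltnP m n.
    rewrite (@series_single _ _ m)// ?eqxx// => k /negPf ->.
    by rewrite nrm0 mul0r.
  rewrite /series/= big_nat big1 => [|k /andP[_ kn]].
    by apply: le_trans cM; rewrite mulr_ge0 ?nrm_ge0 ?exprn_ge0.
  by rewrite ltn_eqF ?nrm0 ?mul0r// (leq_trans kn).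
have := @tends_series_single
  (fun k => (if k == m then c else 0) * (w - z) ^+ k) m.
by rewrite eqxx; apply => k /negPf ->; rewrite mul0r.
Qed.

Lemma wiener_cst c z r : 0 <= r -> wiener (fun=> c) z r (nrm c).
Proof.
move=> r0; have := @wiener_monomial c 0 z r (nrm c) r0.
rewrite expr0 mulr1 lexx => /(_ isT); apply: wiener_ext => w _.
by rewrite expr0 mulr1.
Qed.

(** Completeness of the Wiener algebra. The coefficients are summed index by index, and exchanging
    finite sums shows that the partial sums converge in the Wiener norm. *)
Lemma wiener_sum (f_ : nat -> C -> C) (M_ : nat -> R) f z r M : 0 < r ->
  (forall j, wiener (f_ j) z r (M_ j)) -> (forall n, series M_ n <= M) ->
  (forall w, nrm (w - z) <= r -> tends (series (fun j => f_ j w)) (f w)) ->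
  wiener f z r M.
Proof.
move=> r0 /choice[A AP] MM fE.
have A_le j k : nrm (A j k) * r ^+ k <= M_ j.
  exact: pser_coef (ltW r0) (AP j).
have M0 j : 0 <= M_ j.
  by apply: le_trans (A_le j 0%N); rewrite expr0 mulr1 nrm_ge0.
have : forall k, exists l, tends (series (fun j => A j k)) l.
  move=> k; apply: (@abs_cvg_series _ _ (M / r ^+ k)) => n.
  rewrite ler_pdivlMr ?exprn_gt0// (le_trans _ (MM n))// /series/= mulr_suml.
  by apply: ler_sum => j _; exact: A_le.
move=> /choice[a aP].
(* The Wiener distance from [a] to the [J]-th partial sum is at most the tail of [M_]: this holds
   for the partial sums up to [m], and then [m] goes to infinity. *)
have tail J e : (forall n, series M_ n - series M_ J <= e) -> forall n,
    series (fun k => nrm (a k - series (fun j => A j k) J) * r ^+ k) n <= e.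
  move=> Je n.
  pose v m := \sum_(0 <= k < n)
    nrm (series (fun j => A j k) m - series (fun j => A j k) J) * r ^+ k.
  have vl : v m @[m --> \oo] --> \sum_(0 <= k < n)
      nrm (a k - series (fun j => A j k) J) * r ^+ k.
    apply: cvg_big => [|k _]; first exact: add_continuous.
    apply: cvgMl; apply: tends_nrm; exact: tendsD (aP k) (tends_cst _).
  apply: (cvgr_to_le vl); exists J => // m /= Jm.
  apply: le_trans (Je m); rewrite sub_series_geq//.
  apply: (@le_trans _ _ (\sum_(0 <= k < n) \sum_(J <= j < m)
      nrm (A j k) * r ^+ k)).
    apply: ler_sum => k _; rewrite sub_series_geq// -mulr_suml.
    by rewrite ler_wpM2r ?exprn_ge0 ?(ltW r0)// nrm_sum.
  rewrite exchange_big/=; apply: ler_sum => j _.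
  by have [/(_ n)] := AP j.
exists a; split=> [n|w wr].
  (* With [J = 0] the comparison is with the zero function, which bounds the norm of [a] itself. *)
  have := tail 0%N M; rewrite {2}/series/= big_geq//.
  move=> /(_ _ n); under eq_fun do rewrite /series/= big_geq// subr0.
  by apply => m; rewrite subr0.
move=> e e0.
have e3 : 0 < e / 3 by rewrite divr_gt0.
have [J JP] := nneg_series_tail M0 MM e3.
have fJ : nrm (f w - series (fun j => f_ j w) J) <= e / 3.
  apply: nrm_series_tail (fE w wr) JP => j.
  by apply: wiener_nrm wr; exists (A j); exact: AP.
have /(_ _ e3)[N NP] : tends
    (fun n => \sum_(0 <= j < J) series (fun k => A j k * (w - z) ^+ k) n)
    (\sum_(0 <= j < J) f_ j w).
  by apply: tends_sum => j; have [_] := AP j; apply.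
exists N => n /NP h2.
(* Three-epsilon argument: [s1] is close to [s2] by [tail], [s2] to [t] because finitely many series
   converge at [w], and [t] to [f w] by the tail of [M_]. *)
pose s1 := series (fun k => a k * (w - z) ^+ k) n.
pose s2 := series (fun k => series (fun j => A j k) J * (w - z) ^+ k) n.
pose t := series (fun j => f_ j w) J.
have {}h2 : nrm (s2 - t) <= e / 3.
  rewrite (_ : s2 = \sum_(0 <= j < J)
    series (fun k => A j k * (w - z) ^+ k) n)//.
  by rewrite /s2 /series/= exchange_big/=; under eq_bigr do rewrite mulr_suml.
have h1 : nrm (s1 - s2) <= e / 3.
  apply: le_trans (tail J (e / 3) JP n); rewrite /s1 /s2 /series/= -sumrB.
  rewrite (le_trans (nrm_sum _ _ _))// ler_sum// => k _.
  rewrite -mulrBl nrmM nrmX ler_wpM2l ?nrm_ge0// lerXn2r ?nnegrE ?nrm_ge0//.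
  exact: ltW.
move: fJ; rewrite -/t (nrmB (f w)) -/s1 => fJ.
have := nrmDB s1 s2 (f w); have := nrmDB s2 t (f w); lra.
Qed.

End Wiener.

(** * Operations in Wiener algebras *)

Section WienerAlgebra.
Context {R : realType}.
Local Notation C := R[i].
Implicit Types (f g u : C -> C) (a : nat -> C) (z w c : C) (r M N t : R).

Lemma wienerD f g z r M N : 0 <= r -> wiener f z r M -> wiener g z r N ->
  wiener (fun w => f w + g w) z r (M + N).
Proof.
move=> r0 [a [aM af]] [b [bN bg]]; exists (fun k => a k + b k).
split=> [n|w wr].
  apply: le_trans (lerD (aM n) (bN n)); rewrite /series/= -big_split/=.
  by apply: ler_sum => k _; rewrite -mulrDl ler_wpM2r ?exprn_ge0// nrmD.
apply: (tends_eq _ (tendsD (af w wr) (bg w wr))) => n.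
by rewrite /series/= -big_split/=; apply: eq_bigr => k _; rewrite mulrDl.
Qed.

Lemma wienerZ c f z r M : wiener f z r M ->
  wiener (fun w => c * f w) z r (nrm c * M).
Proof.
move=> [a [aM af]]; exists (fun k => c * a k); split=> [n|w wr].
  apply: le_trans (ler_wpM2l (nrm_ge0 c) (aM n)); rewrite /series/= mulr_sumr.
  by apply: ler_sum => k _; rewrite nrmM mulrA.
apply: (tends_eq _ (tendsZ c (af w wr))) => n.
by rewrite /series/= mulr_sumr; apply: eq_bigr => k _; rewrite mulrA.
Qed.

Lemma wienerB f g z r M N : 0 <= r -> wiener f z r M -> wiener g z r N ->
  wiener (fun w => f w - g w) z r (M + N).
Proof.
move=> r0 fM /(wienerZ (-1)); rewrite nrmN nrm1 mul1r => /(wienerD r0 fM).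
by apply: wiener_ext => w _; rewrite mulN1r.
Qed.

Lemma wiener_mulX f z r M : 0 <= r -> wiener f z r M ->
  wiener (fun w => (w - z) * f w) z r (r * M).
Proof.
move=> r0 [a [aM af]]; exists (fun k => if k is k'.+1 then a k' else 0).
split=> [[|n]|w wr].
- rewrite /series/= big_geq// mulr_ge0//.
  by have := aM 0%N; rewrite /series/= big_geq.
- apply: le_trans (ler_wpM2l r0 (aM n)); rewrite /series/= big_nat_recl//=.
  rewrite nrm0 mul0r add0r mulr_sumr.
  by apply: ler_sum => k _; rewrite exprS mulrCA.
- apply/tends_shift; apply: (tends_eq _ (tendsZ (w - z) (af w wr))) => n.
  rewrite /series/= big_nat_recl//= mul0r add0r mulr_sumr.
  by apply: eq_bigr => k _; rewrite exprS mulrCA.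
Qed.

Lemma wiener_mulXn f z r M n : 0 <= r -> wiener f z r M ->
  wiener (fun w => (w - z) ^+ n * f w) z r (r ^+ n * M).
Proof.
move=> r0 fM; elim: n => [|n /(wiener_mulX r0)].
  by rewrite mul1r; apply: wiener_ext fM => w _; rewrite mul1r.
by rewrite mulrA -exprS; apply: wiener_ext => w _; rewrite mulrA -exprS.
Qed.

(** The product is the sum of the functions [a j * ((w - z) ^+ j * g w)]; completeness takes the
    place of a Cauchy product. *)
Lemma wienerM f g z r M N : 0 < r -> wiener f z r M -> wiener g z r N ->
  wiener (fun w => f w * g w) z r (M * N).
Proof.
move=> r0 [a [aM af]] gN; have N0 := wiener_ge0 gN.
apply: (wiener_sum r0 (fun j => wienerZ (a j) (wiener_mulXn j (ltW r0) gN))).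
  move=> n; apply: le_trans (ler_wpM2r N0 (aM n)); rewrite /series/= mulr_suml.
  by apply: ler_sum => k _; rewrite mulrA.
move=> w wr; rewrite mulrC; apply: (tends_eq _ (tendsZ (g w) (af w wr))) => n.
rewrite /series/= mulr_sumr; apply: eq_bigr => k _.
by rewrite mulrC mulrA.
Qed.

Lemma wienerX f z r M n : 0 < r -> wiener f z r M ->
  wiener (fun w => f w ^+ n) z r (M ^+ n).
Proof.
move=> r0 fM; elim: n => [|n IH].
  by have := wiener_cst 1 z (ltW r0); rewrite nrm1.
by rewrite exprS; apply: wiener_ext (wienerM r0 fM IH) => w _; rewrite exprS.
Qed.

Lemma tends_uniq (u : nat -> C) (l m : C) : tends u l -> tends u m -> l = m.
Proof.
move=> ul um; apply/eqP; rewrite -subr_eq0 -nrm_eq0 eq_le nrm_ge0 andbT.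
apply/ler_addgt0Pr => e e0; rewrite add0r.
have e2 : 0 < e / 2 by rewrite divr_gt0.
have [N NP] := ul _ e2; have [K KP] := um _ e2.
have := NP _ (leq_maxl N K); have := KP _ (leq_maxr N K).
rewrite (nrmB _ l); have := nrmDB l (u (maxn N K)) m; lra.
Qed.

(** Division by [w - z] shifts the coefficients. As [g] is the difference quotient at every
    [w != z], the factorisation also holds outside the disc. *)
Lemma pser_div f z r M a : 0 < r -> pser f z r M a -> f z = a 0%N /\
  exists g, pser g z r (M / r) (fun k => a k.+1) /\
    forall w, f w = a 0%N + (w - z) * g w.
Proof.
move=> r0 [aM af].
have fz : f z = a 0%N.
  have /af af0 : nrm (z - z) <= r by rewrite subrr nrm0 ltW.
  apply: tends_uniq af0 _.
  rewrite -[X in tends _ X]mulr1 -[X in _ * X](expr0 (z - z)).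
  apply: (@tends_series_single _ (fun k => a k * (z - z) ^+ k)).
  by move=> -[//|k] _; rewrite subrr expr0n mulr0.
split=> //.
exists (fun w => if w == z then a 1%N else (f w - a 0%N) / (w - z)).
split; last first.
  move=> w; have [->|wz] := eqVneq w z; first by rewrite subrr mul0r addr0.
  by rewrite mulrC divfK ?subr_eq0// subrKC.
split=> [n|w wr].
  rewrite ler_pdivlMr// (le_trans _ (aM n.+1))// /series/= big_nat_recl//=.
  rewrite mulr_suml -[leLHS]add0r lerD ?mulr_ge0 ?nrm_ge0// ler_sum// => k _.
  by rewrite -mulrA -exprSr.
have [->|wz] := eqVneq w z.
  rewrite -[X in tends _ X]mulr1 -[X in _ * X](expr0 (z - z)).
  apply: (@tends_series_single _ (fun k => a k.+1 * (z - z) ^+ k)).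
  by move=> -[//|k] _; rewrite subrr expr0n mulr0.
have {}wz : w - z != 0 by rewrite subr_eq0.
rewrite mulrC; apply: tends_eq (tendsZ (w - z)^-1 (tendsD
  ((tends_shift _ _).2 (af w wr)) (tends_cst (- a 0%N)))) => n.
rewrite /series/= big_nat_recl//= expr0 mulr1 addrAC subrr add0r mulr_sumr.
by apply: eq_bigr => k _; rewrite exprS mulrCA mulKf.
Qed.

Lemma wiener_div f z r M : 0 < r -> wiener f z r M -> exists2 g,
  wiener g z r (M / r) & forall w, f w = f z + (w - z) * g w.
Proof.
move=> r0 [a /(pser_div r0)[-> [g [ga fE]]]]; exists g => //.
by exists (fun k => a k.+1).
Qed.

Lemma tends_geometric (x : C) : nrm x < 1 ->
  tends (series (fun j => x ^+ j)) (1 - x)^-1.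
Proof.
move=> x1 e e0.
have x10 : 1 - x != 0.
  by apply: contraTneq x1 => /subr0_eq <-; rewrite nrm1 ltxx.
have : (nrm x) ^+ n @[n --> \oo] --> (0 : R).
  by apply: cvg_expr; rewrite ger0_norm ?nrm_ge0.
move/cvgrPdist_le => /(_ (e * nrm (1 - x))).
rewrite mulr_gt0 ?nrm_gt0// => /(_ isT)[N _ NP]; exists N => n /NP/=.
rewrite sub0r normrN ger0_norm ?exprn_ge0 ?nrm_ge0//.
rewrite -ler_pdivrMr ?nrm_gt0// -nrmV -nrmX -nrmM; congr (_ <= _).
have -> : series (fun j => x ^+ j) n = (1 - x ^+ n) / (1 - x).
  by rewrite -opprB subrX1 -mulNr opprB /series/= big_mkord mulrC mulKf.
by rewrite mulrBl mul1r addrAC subrr add0r nrmN.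
Qed.

Lemma geometric_le t n : 0 <= t -> t < 1 ->
  series (fun j => t ^+ j) n <= (1 - t)^-1.
Proof.
move=> t0 t1; rewrite -[leRHS]mul1r ler_pdivlMr ?subr_gt0//.
rewrite /series/= big_mkord mulrC -[1 - t]opprB mulNr -subrX1 opprB.
by rewrite lerBlDr lerDl exprn_ge0.
Qed.

(** Neumann series: by submultiplicativity the [j]-th power has norm at most [t ^+ j]. *)
Lemma wiener_geometric u z r t : 0 < r -> wiener u z r t -> t < 1 ->
  wiener (fun w => (1 - u w)^-1) z r (1 - t)^-1.
Proof.
move=> r0 ut t1; apply: (wiener_sum r0 (fun j => wienerX j r0 ut)) => [n|w wr].
  exact: geometric_le (wiener_ge0 ut) t1.
by apply: tends_geometric; rewrite (le_lt_trans (wiener_nrm ut wr)).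
Qed.

End WienerAlgebra.

(** * Stability of analyticity under the usual operations *)

Section Analytic.
Context {R : realType}.
Local Notation C := R[i].
Implicit Types (f g : C -> C) (z w c : C) (r M N : R).

Lemma wiener_analytic f z r M : 0 < r -> wiener f z r M -> analytic_at f z.
Proof.
move=> r0 [a [_ af]]; exists a; apply/near_nrmP; exists r => // w wr.
by apply/cvg_tends; exact: af.
Qed.

(** [analytic_at] gives pointwise convergence near [z]. Convergence at [z + r%:C] bounds the terms,
    so on the disc of half the radius they are dominated by a geometric series whose sum is at most
    twice the bound. *)
Lemma analytic_wiener f z : analytic_at f z ->
  exists r M, 0 < r /\ wiener f z r M.
Proof.
move=> [a /near_nrmP[r r0 af]].
have : nrm ((z + r%:C) - z) <= r by rewrite addrC addKr nrm_real// ltW.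
move=> /af; rewrite addrAC subrr add0r => /pseries_coef_bound[M M0 aM].
have {aM} aM k : nrm (a k) * r ^+ k <= complex.Re M.
  have := aM k; rewrite nrmE nrmE nrm_real ?(ltW r0)//.
  by rewrite -rmorphXn -rmorphM /= lecE/= => /andP[].
exists (r / 2), (complex.Re M * 2); split; first by rewrite divr_gt0.
exists a; split=> [n|w wr].
  apply: (@le_trans _ _ (complex.Re M * series (fun k => 2^-1 ^+ k) n)).
    rewrite /series/= mulr_sumr ler_sum// => k _.
    by rewrite expr_div_n mulrA -exprVn ler_wpM2r ?exprn_ge0 ?invr_ge0.
  apply: ler_wpM2l.
    have := aM 0%N; rewrite expr0 mulr1; apply: le_trans; exact: nrm_ge0.
  rewrite (le_trans (geometric_le _ _ _))//; [lra|].
have -> : 1 - 2^-1 = 2^-1 :> R by lra.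
by rewrite invrK.
by apply/cvg_tends/af; rewrite (le_trans wr)//; lra.
Qed.

Lemma analytic_ext f g z : (\forall w \near z, f w = g w) ->
  analytic_at f z -> analytic_at g z.
Proof.
move=> fg [a fa]; exists a; apply: filterS2 fg fa => w -> //.
Qed.

Lemma eq_analytic f g z : f =1 g -> analytic_at f z -> analytic_at g z.
Proof. by move=> /funext ->. Qed.

Lemma analytic_cst c z : analytic_at (fun=> c) z.
Proof. exact: analytic_at_cst. Qed.

Lemma analyticD f g z : analytic_at f z -> analytic_at g z ->
  analytic_at (fun w => f w + g w) z.
Proof. exact: analytic_atD. Qed.

Lemma analyticN f z : analytic_at f z -> analytic_at (fun w => - f w) z.
Proof. exact: analytic_atN. Qed.

Lemma analyticB f g z : analytic_at f z -> analytic_at g z ->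
  analytic_at (fun w => f w - g w) z.
Proof. by move=> fz gz; exact: analyticD fz (analyticN gz). Qed.

Lemma analyticM f g z : analytic_at f z -> analytic_at g z ->
  analytic_at (fun w => f w * g w) z.
Proof. exact: analytic_atM (@cvg_exp_half_complex R). Qed.

Lemma analytic_sum (I : Type) (s : seq I) (P : pred I) (F : I -> C -> C) z :
  (forall i, P i -> analytic_at (F i) z) ->
  analytic_at (fun w => \sum_(i <- s | P i) F i w) z.
Proof.
move=> Fz; elim: s => [|i s IH].
  by apply: (eq_analytic _ (analytic_cst 0 z)) => w; rewrite big_nil.
have [Pi|Pi] := boolP (P i).
  apply: (eq_analytic _ (analyticD (Fz i Pi) IH)).
by move=> w; rewrite big_cons Pi.
by apply: (eq_analytic _ IH) => w; rewrite big_cons (negPf Pi).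
Qed.

Lemma analytic_prod (I : Type) (s : seq I) (F : I -> C -> C) z :
  (forall i, analytic_at (F i) z) ->
  analytic_at (fun w => \prod_(i <- s) F i w) z.
Proof.
move=> Fz; elim: s => [|i s IH].
  by apply: (eq_analytic _ (analytic_cst 1 z)) => w; rewrite big_nil.
by apply: (eq_analytic _ (analyticM (Fz i) IH)) => w; rewrite big_cons.
Qed.

Lemma analyticX f z n : analytic_at f z -> analytic_at (fun w => f w ^+ n) z.
Proof.
move=> fz; elim: n => [|n IH]; first exact: analytic_cst.
by apply: (eq_analytic _ (analyticM fz IH)) => w; rewrite exprS.
Qed.

Lemma analytic_horner (p : {poly C}) f z : analytic_at f z ->
  analytic_at (fun w => p.[f w]) z.
Proof.
move=> fz; elim/poly_ind: p => [|p c IH].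
  by apply: (eq_analytic _ (analytic_cst 0 z)) => w; rewrite horner0.
apply: (eq_analytic _ (analyticD (analyticM IH fz) (analytic_cst c z))).
by move=> w; rewrite !hornerE.
Qed.

Lemma analytic_id z : analytic_at id z.
Proof.
have r1 : (0 : R) < 1 by [].
have X : wiener (fun w => 1 * (w - z) ^+ 1) z 1 1.
  by apply: wiener_monomial; rewrite ?nrm1 ?mulr1.
apply: (eq_analytic _ (analyticD (analytic_cst z z) (wiener_analytic r1 X))).
by move=> w; rewrite mul1r subrKC.
Qed.

Lemma analytic_div f z : analytic_at f z -> exists2 g,
  analytic_at g z & forall w, f w = f z + (w - z) * g w.
Proof.
move=> /analytic_wiener[r [M [r0 /(wiener_div r0)[g gM fE]]]].
by exists g => //; exact: wiener_analytic gM.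
Qed.

Lemma analytic_continuous f z e : analytic_at f z -> 0 < e ->
  \forall w \near z, nrm (f w - f z) <= e.
Proof.
move=> /analytic_wiener[r [M [r0 /(wiener_div r0)[g gM fE]]]] e0.
(* [M / r] bounds the difference quotient [g]; adding 1 keeps the denominator positive. *)
have N0 : 0 < M / r + 1 by have := wiener_ge0 gM; lra.
apply/near_nrmP; exists (Num.min r (e / (M / r + 1))).
  by rewrite lt_min r0 divr_gt0.
move=> w; rewrite le_min => /andP[wr we].
rewrite fE addrAC subrr add0r nrmM.
have := wiener_nrm gM wr; move: we; rewrite ler_pdivlMr// => we gw.
by apply: le_trans we; rewrite ler_wpM2l ?nrm_ge0//; lra.
Qed.

Lemma analytic_neq0 f z : analytic_at f z -> f z != 0 ->
  \forall w \near z, f w != 0.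
Proof.
move=> fz fz0; have e0 : 0 < nrm (f z) / 2 by rewrite divr_gt0 ?nrm_gt0.
apply: filterS (analytic_continuous fz e0) => w; apply: contraTneq => ->.
by rewrite sub0r nrmN -ltNge; move: e0; lra.
Qed.

Lemma analyticV f z : analytic_at f z -> f z != 0 ->
  analytic_at (fun w => (f w)^-1) z.
Proof.
move=> /analytic_wiener[r [M [r0 /(wiener_div r0)[g gM fE]]]] fz0.
have M0 := wiener_ge0 gM.
have m0 : 0 < nrm (f z) by rewrite nrm_gt0.
(* Write [f w = f z * (1 - u w)] with [u w = - (w - z) * g w / f z]; this radius brings the norm of
   [u] below 1. *)
pose s := Num.min r (nrm (f z) / (2 * (M / r + 1))).
have s0 : 0 < s by rewrite lt_min r0 divr_gt0// mulr_gt0//; lra.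
have sr : s <= r by rewrite ge_min lexx.
have uM := wienerZ (- (f z)^-1)
  (wiener_mulX (ltW s0) (wiener_shrink (ltW s0) sr gM)).
have /(wiener_geometric s0 uM)/(wienerZ (f z)^-1)/(wiener_analytic s0) :
    nrm (- (f z)^-1) * (s * (M / r)) < 1.
  rewrite nrmN nrmV mulrC ltr_pdivrMr// mul1r.
  have : s <= nrm (f z) / (2 * (M / r + 1)) by rewrite ge_min lexx orbT.
  rewrite ler_pdivlMr ?mulr_gt0//; last by lra.
  have := mulr_ge0 (ltW s0) M0; nra.
apply: eq_analytic => w.
rewrite mulNr opprK -invfM mulrDr mulr1 mulrA mulrA mulfV// mul1r.
by rewrite -fE.
Qed.

End Analytic.

(** * Zeros, and approximation on an exhaustion of an open set *)

Section Zeros.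
Context {R : realType}.
Local Notation C := R[i].
Implicit Types (f g : C -> C) (a : nat -> C) (z w c : C) (r M : R).

Lemma pser_divXn f z r M a m : 0 < r -> pser f z r M a ->
  (forall k, (k < m)%N -> a k = 0) ->
  exists g N, pser g z r N (fun k => a (m + k)%N) /\
    forall w, f w = (w - z) ^+ m * g w.
Proof.
move=> r0; elim: m f a M => [|m IH] f a M fa a0.
  by exists f, M; split=> // w; rewrite mul1r.
have [_ [g [ga fE]]] := pser_div r0 fa.
have [k km|h [N [hN gE]]] := IH _ _ _ ga; first exact: a0.
exists h, N; split=> // w.
by rewrite fE (a0 0%N)// add0r gE mulrA -exprS.
Qed.

(** [m] is the index of the first nonzero coefficient; if there is none, the germ vanishes. *)
Lemma analytic_zeros f z : analytic_at f z ->
  (\forall w \near z, f w = 0) \/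
  exists m k, [/\ analytic_at k z, k z != 0 &
    forall w, f w = (w - z) ^+ m * k w].
Proof.
move=> /analytic_wiener[r [M [r0 [a fa]]]].
have [a0|] := pselect (forall k, a k = 0).
  left; apply/near_nrmP; exists r => // w wr; have [_ /(_ w wr) af] := fa.
  apply: tends_uniq af _; apply: (@tends_near_cst _ _ _ 0%N) => n _.
  by rewrite /series/= big1// => k _; rewrite a0 mul0r.
move=> /existsNP/cid[k0 /eqP ak0]; right.
have exa : exists k, a k != 0 by exists k0.
have [m am m_min] := ex_minnP exa.
have [k km|g [N [gN fE]]] := pser_divXn (m := m) r0 fa.
  by apply/eqP; apply: contraTT km => /m_min; rewrite -leqNgt.
exists m, g; split=> //.
  by apply: (@wiener_analytic _ g z r N r0); exists (fun k => a (m + k)%N).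
by have [->] := pser_div r0 gN; rewrite addn0.
Qed.

Lemma analytic_isolated_zeros f z : analytic_at f z ->
  ~ (\forall w \near z, f w = 0) -> \forall w \near z, w != z -> f w != 0.
Proof.
move=> /analytic_zeros[//|[m [k [kz kz0 fE]]]] _.
apply: filterS (analytic_neq0 kz kz0) => w kw wz.
by rewrite fE mulf_neq0// expf_neq0// subr_eq0.
Qed.

(** By continuity a nonzero value at [z] would persist at a nearby point [z + r%:C], distinct from
    [z]. *)
Lemma analytic_identity f z : analytic_at f z ->
  (\forall w \near z, w != z -> f w = 0) -> f z = 0.
Proof.
move=> fz f0; apply/eqP/negPn/negP => fz0.
have : \forall w \near z, f w != 0 /\ (w != z -> f w = 0).
  exact: filterI (analytic_neq0 fz fz0) f0.
move=> /near_nrmP[r r0 rP].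
have [] := rP (z + r%:C).
  by rewrite addrC addKr nrm_real// ltW.
move=> /eqP + fw; apply; apply: fw.
by rewrite -subr_eq0 addrC addKr -nrm_gt0 nrm_real// ltW.
Qed.

(** Principal parts are encoded as polynomials in [(w - z)^-1]. Each step of the induction splits
    off [f z], which contributes the monomial of degree [m.+1]. *)
Lemma analytic_laurent f z m : analytic_at f z ->
  exists (P : {poly C}) g, analytic_at g z /\
    forall w, w != z -> f w / (w - z) ^+ m = P.[(w - z)^-1] + g w.
Proof.
elim: m f => [|m IH] f fz.
  by exists 0, f; split=> // w _; rewrite horner0 add0r expr0 divr1.
have [g /IH[P [h [hz gE]]] fE] := analytic_div fz.
exists (f z *: 'X^(m.+1) + P), h; split=> // w wz.
have wz0 : w - z != 0 by rewrite subr_eq0.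
rewrite !hornerE -addrA -gE// fE mulrDl exprVn; congr (_ + _).
by rewrite exprS invfM mulrACA mulfV// mul1r.
Qed.

End Zeros.

Section Exhaustion.
Context {R : realType}.
Local Notation C := R[i].
Variable U : set C.
Implicit Types (f g q v : C -> C) (a b z w c : C) (r M : R) (n : nat).

(** The usual exhaustion by compact sets; the distance to the complement is bounded point by point,
    so that [U] may be the whole plane. *)
Definition exhaustion n : set C :=
  [set a | nrm a <= n%:R /\ forall b, ~ U b -> n.+1%:R^-1 <= nrm (a - b)].

(** By the triangle inequality the closed disc lies in [exhaustion n]; stating this at the centre
    gives explicit margins. *)
Definition exhaustion_disc n z r := [/\ 0 < r, nrm z + r <= n%:R &
  forall b, ~ U b -> r + n.+1%:R^-1 <= nrm (z - b)].

Lemma exhaustion_disc_center n z r : exhaustion_disc n z r -> exhaustion n z.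
Proof.
move=> [r0 zr zU]; split; first by rewrite (le_trans _ zr)// lerDl ltW.
by move=> b /zU; apply: le_trans; rewrite lerDr ltW.
Qed.

Lemma exhaustion_discS m n z r : (m <= n)%N ->
  exhaustion_disc m z r -> exhaustion_disc n z r.
Proof.
move=> mn [r0 zr zU]; split=> //.
  by rewrite (le_trans zr)// ler_nat.
move=> b /zU; apply: le_trans; rewrite lerD2l.
by rewrite lef_pV2 ?posrE ?ltr0n// ler_nat ltnS.
Qed.

Lemma exhaustion_disc_exists z : open U -> U z ->
  exists n r, exhaustion_disc n z r.
Proof.
move=> oU Uz; have : nbhs z U by exact: open_nbhs_nbhs.
move=> /near_nrmP[r r0 rU].
(* The disc of radius [r] lies in [U]. Half of [r] becomes the radius, and the other half absorbs
   [n.+1%:R^-1]. *)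
pose n := maxn (Num.bound (nrm z + r / 2)) (Num.bound (r / 2)^-1).
have r2 : 0 < r / 2 by rewrite divr_gt0.
exists n, (r / 2); split=> // [|b bU].
  rewrite (le_trans (ltW (archi_boundP _)))//.
    by rewrite addr_ge0 ?nrm_ge0// ltW.
  by rewrite ler_nat leq_maxl.
have rb : r < nrm (b - z) by rewrite ltNge; apply/negP => /rU.
rewrite nrmB (le_trans _ (ltW rb))//.
rewrite [leRHS](splitr r) lerD2l -[leRHS]invrK.
rewrite lef_pV2 ?posrE ?invr_gt0 ?ltr0n//.
rewrite (le_trans (ltW (archi_boundP _))) ?invr_ge0 ?(ltW r2)//.
by rewrite ler_nat (leq_trans (leq_maxr _ _) (leqnSn _)).
Qed.

(** An infinite intersection would accumulate in a square. No point can be an accumulation point: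
    those of [U] by hypothesis, the others because [exhaustion n] keeps at a distance from them. *)
Lemma exhaustion_finite n (D : set C) : open U ->
  (forall z, U z -> \forall w \near z, w != z -> ~ D w) ->
  finite_set (exhaustion n `&` D).
Proof.
move=> oU DU; pose E := exhaustion n `&` D.
pose pt (p : R * R) : C := p.1 +i* p.2.
have isolated z : exists r, 0 < r /\
    forall w, nrm (w - z) <= r -> w != z -> ~ E w.
  have [/DU/near_nrmP[r r0 rP]|zU] := pselect (U z).
    by exists r; split=> // w /rP wD /wD nDw [].
  exists (n.+1%:R^-1 / 2); split; first by rewrite divr_gt0// invr_gt0.
  move=> w wz _ [[_ /(_ _ zU)] + _]; apply/negP; rewrite -ltNge.
  by rewrite (le_lt_trans wz)// ltr_pdivrMr// ltr_pMr ?invr_gt0// ltr1n.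
have [r_ r_P] := choice isolated.
have K : compact (`[- n%:R, n%:R] `*` `[- n%:R, n%:R] : set (R * R)).
  by apply: compact_setX; exact: segment_compact.
pose E' := pt @^-1` E.
suff fE' : finite_set E'.
  apply: sub_finite_set (finite_image pt fE') => -[x y] Exy.
  by exists (x, y).
apply: contrapT => iE'.
(* The sets that miss only finitely many points of [E']; a cluster point of this filter is an
   accumulation point of [E']. *)
pose F : set_system (R * R) := [set S | finite_set (E' `\` S)].
have FF : ProperFilter F.
  split; first by rewrite /F/= setD0.
  split=> [|S S' FS FS'|S S' SS']; rewrite /F/=.
  - by rewrite setDT; exact: finite_set0.
  - by rewrite setDIr; rewrite finite_setU.
  - by apply: sub_finite_set; exact: setDS.
have [|p [_ pF]] := K F FF.
  rewrite /F/= (_ : _ `\` _ = set0); first exact: finite_set0.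
  apply/seteqP; split=> // -[x y] [[[an _] _] nK]; apply: nK.
  split=> /=; rewrite in_itv/= -ler_norml (le_trans _ an)//.
    exact: (normr_Re_le (x +i* y)).
  exact: (normr_Im_le (x +i* y)).
have [rp0 rP] := r_P (pt p).
have [|q [[Eq qp] pq]] := pF (E' `\` [set p]) (ball p (r_ (pt p) / 2)) _
  (nbhsx_ballx _ _ (divr_gt0 rp0 (ltr0Sn _ 1))).
  by rewrite /F/= setDD; apply: finite_setIr; exact: finite_set1.
apply: (rP (pt q)) Eq; last first.
  apply/eqP => -[qp1 qp2]; apply: qp.
  by rewrite /= [q]surjective_pairing qp1 qp2 -surjective_pairing.
rewrite (le_trans (nrm_le_ReIm _))//.
have [/= pq1 pq2] := pq; rewrite [leRHS](splitr (r_ _)) lerD//.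
  by rewrite distrC ltW.
by rewrite distrC ltW.
Qed.

(** Approximation is in the Wiener norm, uniformly over all discs of level [n]. The uniform bound is
    what makes products approximable. *)
Definition approximable n f :=
  (exists2 M, 0 <= M & forall z r, exhaustion_disc n z r -> wiener f z r M) /\
  forall e, 0 < e -> exists2 q, (forall z, U z -> analytic_at q z) &
    forall z r, exhaustion_disc n z r -> wiener (fun w => f w - q w) z r e.

Lemma approximable_ext n f g :
  (forall z r w, exhaustion_disc n z r -> nrm (w - z) <= r -> f w = g w) ->
  approximable n f -> approximable n g.
Proof.
move=> fg [[M M0 fM] fq]; split=> [|e /fq[q qU fqe]].
  by exists M => // z r zr; apply: wiener_ext (fM z r zr) => w; exact: fg zr.
exists q => // z r zr; apply: wiener_ext (fqe z r zr) => w wr.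
by rewrite (fg _ _ _ zr wr).
Qed.

Lemma approximable_analytic n f M : 0 <= M ->
  (forall z, U z -> analytic_at f z) ->
  (forall z r, exhaustion_disc n z r -> wiener f z r M) -> approximable n f.
Proof.
move=> M0 fU fM; split=> [|e e0]; first by exists M.
exists f => // z r [r0 _ _].
have := wiener_cst 0 z (ltW r0); rewrite nrm0 => /(wiener_le (ltW e0)).
by apply: wiener_ext => w _; rewrite subrr.
Qed.

Lemma approximable_cst n c : approximable n (fun=> c).
Proof.
apply: (@approximable_analytic n _ (nrm c)) => [|z _|z r [r0 _ _]].
- exact: nrm_ge0.
- exact: analytic_cst.
- exact: wiener_cst (ltW r0).
Qed.

Lemma approximableD n f g : approximable n f -> approximable n g ->
  approximable n (fun w => f w + g w).
Proof.
move=> [[M M0 fM] fp] [[N N0 gN] gq]; split=> [|e e0].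
  exists (M + N) => [|z r zr]; first exact: addr_ge0.
  by have [r0 _ _] := zr; apply: wienerD (ltW r0) (fM _ _ zr) (gN _ _ zr).
have e2 : 0 < e / 2 by rewrite divr_gt0.
have [p pU pe] := fp _ e2; have [q qU qe] := gq _ e2.
exists (fun w => p w + q w) => [z Uz|z r zr].
  by apply: analyticD; [exact: pU|exact: qU].
have [r0 _ _] := zr.
have := wienerD (ltW r0) (pe _ _ zr) (qe _ _ zr); rewrite -splitr.
by apply: wiener_ext => w _; rewrite opprD addrACA.
Qed.

Lemma approximableM n f g : approximable n f -> approximable n g ->
  approximable n (fun w => f w * g w).
Proof.
move=> [[M M0 fM] fp] [[N N0 gN] gq]; split=> [|e e0].
  exists (M * N) => [|z r zr]; first exact: mulr_ge0.
  by have [r0 _ _] := zr; apply: wienerM r0 (fM _ _ zr) (gN _ _ zr).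
have MN : 0 < M + N + 1 by lra.
(* [f g - p q = f (g - q) + (f - p) q] has norm at most [M d + d (N + d)], which this choice of [d]
   keeps below [e]. *)
pose d := Num.min 1 (e / (M + N + 1)).
have d0 : 0 < d by rewrite lt_min ltr01 divr_gt0.
have [p pU pd] := fp _ d0; have [q qU qd] := gq _ d0.
exists (fun w => p w * q w) => [z Uz|z r zr].
  by apply: analyticM; [exact: pU|exact: qU].
have [r0 _ _] := zr; have r0' := ltW r0.
have qN : wiener q z r (N + d).
  apply: wiener_ext (wienerB r0' (gN _ _ zr) (qd _ _ zr)) => w _.
  by rewrite subKr.
have := wienerD r0' (wienerM r0 (fM _ _ zr) (qd _ _ zr))
                    (wienerM r0 (pd _ _ zr) qN).
move=> /(wiener_le (N := e)) H; apply: wiener_ext (H _) => [w _|].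
  by ring.
have : d <= 1 by rewrite ge_min lexx.
have : d * (M + N + 1) <= e by rewrite -ler_pdivlMr// ge_min lexx orbT.
nra.
Qed.

Lemma approximable_horner n f (p : {poly C}) : approximable n f ->
  approximable n (fun w => p.[f w]).
Proof.
move=> fn; elim/poly_ind: p => [|p c IH].
  by apply: approximable_ext (approximable_cst n 0) => *; rewrite horner0.
apply: approximable_ext (approximableD (approximableM IH fn)
  (approximable_cst n c)) => *.
by rewrite !hornerE.
Qed.

Lemma approximable_sum n (I : eqType) (s : seq I) (F : I -> C -> C) :
  (forall i, i \in s -> approximable n (F i)) ->
  approximable n (fun w => \sum_(i <- s) F i w).
Proof.
elim: s => [_|i s IH sn].
  by apply: approximable_ext (approximable_cst n 0) => *; rewrite big_nil.
apply: approximable_ext (approximableD (sn i _) (IH _)) => *.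
- by rewrite big_cons.
- exact: mem_head.
- by apply: sn; rewrite inE orbC; apply/orP; left.
Qed.

(** The approximants are truncated geometric series; the remainder [v ^+ J / (1 - v)] has norm at
    most [t ^+ J / (1 - t)]. *)
Lemma approximable_geometric n v t : 0 <= t -> t < 1 ->
  (forall z, U z -> analytic_at v z) ->
  (forall z r, exhaustion_disc n z r -> wiener v z r t) ->
  approximable n (fun w => (1 - v w)^-1).
Proof.
move=> t0 t1 vU vt; have t10 : 0 < 1 - t by rewrite subr_gt0.
split=> [|e e0].
  exists (1 - t)^-1 => [|z r zr]; first by rewrite invr_ge0 ltW.
  by have [r0 _ _] := zr; exact: wiener_geometric r0 (vt _ _ zr) t1.
have : t ^+ n @[n --> \oo] --> (0 : R) by apply: cvg_expr; rewrite ger0_norm.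
move/cvgrPdist_le => /(_ (e * (1 - t)) (mulr_gt0 e0 t10))[J _ /(_ J (leqnn _))].
rewrite /= sub0r normrN ger0_norm ?exprn_ge0// => Je.
exists (fun w => \sum_(j < J) v w ^+ j) => [z Uz|z r zr].
  by apply: analytic_sum => j _; apply: analyticX; exact: vU.
have [r0 _ _] := zr.
have := wienerM r0 (wienerX J r0 (vt _ _ zr))
                   (wiener_geometric r0 (vt _ _ zr) t1).
move=> /(wiener_le (N := e)) H; apply: wiener_ext (H _) => [w wr|].
  have vw : 1 - v w != 0.
    apply: contraTneq t1 => /subr0_eq vw; rewrite -leNgt -(@nrm1 R) vw.
    exact: wiener_nrm (vt _ _ zr) wr.
  have E : (\sum_(j < J) v w ^+ j) * (1 - v w) = 1 - v w ^+ J.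
    by rewrite mulrC -[1 - v w]opprB mulNr -subrX1 opprB.
  by apply: (mulIf vw); rewrite mulfVK// mulrBl mulVf// E subKr.
by rewrite ler_pdivrMr.
Qed.

(** Geometric series of ratio [(w - z) / (b - z)]. *)
Lemma wiener_inv_sub b z r : 0 < r -> r < nrm (z - b) ->
  wiener (fun w => (w - b)^-1) z r (nrm (z - b) - r)^-1.
Proof.
move=> r0 rb; have b0 := lt_trans r0 rb.
have zb : z - b != 0 by rewrite -nrm_gt0.
have u : wiener (fun w => - (z - b)^-1 * (w - z) ^+ 1) z r (r / nrm (z - b)).
  by apply: wiener_monomial (ltW r0) _; rewrite nrmN nrmV mulrC.
have t1 : r / nrm (z - b) < 1 by rewrite ltr_pdivrMr// mul1r.
have := wienerZ (z - b)^-1 (wiener_geometric r0 u t1).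
rewrite nrmV -invfM mulrBr mulr1 mulrCA mulfV ?gt_eqF// mulr1.
apply: wiener_ext => w _; rewrite -invfM mulrBr mulr1 mulNr mulrN opprK.
by rewrite mulrA mulfV// mul1r addrC subrKA.
Qed.

(* The pole a is pushed to infinity or to a point b of the complement of U. *)
Lemma approximable_pole n a : ~ exhaustion n a ->
  approximable n (fun w => (w - a)^-1).
Proof.
move=> an; have [na|na] := ltP n%:R (nrm a).
  have a0 : 0 < nrm a by rewrite (le_lt_trans _ na).
  have a0' : a != 0 by rewrite -nrm_gt0.
  (* [(w - a)^-1 = - a^-1 / (1 - w / a)], and [w / a] has norm at most [n%:R / nrm a < 1] on the
     discs of level [n]. *)
  have : approximable n (fun w => (1 - a^-1 * w)^-1).
    apply: (@approximable_geometric _ _ (n%:R / nrm a)) => [|||z r [r0 zr _]].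
    - by rewrite divr_ge0// ltW.
    - by rewrite ltr_pdivrMr// mul1r.
    - by move=> z _; exact: analyticM (analytic_cst _ _) (analytic_id _).
    have X : wiener (fun w => 1 * (w - z) ^+ 1) z r r.
      by apply: wiener_monomial (ltW r0) _; rewrite nrm1 mul1r.
    have := wienerZ a^-1 (wienerD (ltW r0) (wiener_cst z z (ltW r0)) X).
    move=> /(wiener_le (N := n%:R / nrm a)) H.
    apply: wiener_ext (H _) => [w _|].
      by rewrite mul1r subrKC.
    by rewrite nrmV mulrC ler_pM2r ?invr_gt0.
  move=> /(approximableM (approximable_cst n (- a^-1))).
  apply: approximable_ext => _ _ w _ _; rewrite mulNr -invfM -invrN; congr _^-1.
  by rewrite mulrBr mulr1 mulrA mulfV// mul1r opprB.
have [b bU ab] : exists2 b, ~ U b & nrm (a - b) < n.+1%:R^-1.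
  apply: contrapT => nb; apply: an; split=> // b bU; rewrite leNgt.
  by apply/negP => ab; apply: nb; exists b.
have invb z r : exhaustion_disc n z r ->
    wiener (fun w => (w - b)^-1) z r n.+1%:R.
  move=> [r0 _ /(_ _ bU) zb].
  have rb : r < nrm (z - b) by rewrite (lt_le_trans _ zb)// ltrDl invr_gt0.
  apply: wiener_le (wiener_inv_sub r0 rb).
  by rewrite -[leRHS]invrK lef_pV2 ?posrE ?subr_gt0 ?invr_gt0// lerBrDl.
have Ub z : U z -> z - b != 0.
  by move=> Uz; rewrite subr_eq0; apply: contra_notN bU => /eqP <-.
have anb z : U z -> analytic_at (fun w => (w - b)^-1) z.
  move=> Uz; apply: (@analyticV _ (fun w => w - b)) (Ub _ Uz).
  exact: (analyticB (analytic_id z) (analytic_cst b z)).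
have /approximableM H : approximable n (fun w => (w - b)^-1).
  exact: approximable_analytic anb invb.
(* [(w - a)^-1 = (w - b)^-1 / (1 - (a - b) / (w - b))], where the ratio has norm at most
   [nrm (a - b) * n.+1%:R < 1]. *)
have /H : approximable n (fun w => (1 - (a - b) * (w - b)^-1)^-1).
  apply: (@approximable_geometric _ _ (nrm (a - b) * n.+1%:R)).
  - by rewrite mulr_ge0 ?nrm_ge0.
  - by rewrite -ltr_pdivlMr// div1r.
  - by move=> z /anb; exact: analyticM (analytic_cst _ _).
  - by move=> z r /invb; exact: wienerZ.
apply: approximable_ext => z r w [r0 _ /(_ _ bU) zb] wr.
have wb : w - b != 0.
  rewrite -nrm_gt0; have := nrmDB z w b; rewrite (nrmB z w).
  have : (0 : R) < n.+1%:R^-1 by rewrite invr_gt0.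
  by set x := n.+1%:R^-1 in zb *; lra.
rewrite -invfM mulrBr mulr1 mulrCA mulfV// mulr1; congr _^-1.
by rewrite opprB addrA subrK.
Qed.

End Exhaustion.

(** * Mittag-Leffler and Bezout *)

Section MittagLeffler.
Context {R : realType}.
Local Notation C := R[i].
Implicit Types (z w a : C) (r : R).

Lemma analytic_horner_pole (p : {poly C}) a z : z != a ->
  analytic_at (fun w => p.[(w - a)^-1]) z.
Proof.
move=> za; apply: (@analytic_horner _ _ (fun w => (w - a)^-1)).
apply: (@analyticV _ (fun w => w - a)); last by rewrite subr_eq0.
exact: (analyticB (analytic_id z) (analytic_cst a z)).
Qed.

(** The poles are grouped by the level at which they enter the exhaustion. The finite sum [G n] of
    the principal parts of level [n] has its poles outside the earlier sets, hence is there within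
    [2^-1 ^+ n] of some [q n] analytic on [U]; the solution is the sum of the [G n - q n]. *)
Lemma mittag_leffler (U : set C) (P : C -> {poly C}) : open U ->
  (forall z, U z -> \forall w \near z, w != z -> P w = 0) ->
  exists h : C -> C, forall z, U z ->
    analytic_at (fun w => h w - (P z).[(w - z)^-1]) z.
Proof.
move=> oU PU.
pose level n a := exhaustion U n a /\
  forall m, (m < n)%N -> ~ exhaustion U m a.
have : forall n, exists s : seq C, uniq s /\
    forall a, a \in s <-> level n a /\ P a != 0.
  move=> n; have fin : finite_set [set a | level n a /\ P a != 0].
    apply: (@sub_finite_set _ _ (exhaustion U n `&` [set a | P a != 0])).
      by move=> a [[an _] Pa]; split.
    apply: exhaustion_finite => // z /PU; apply: filterS => w wP wz /=.
    by rewrite wP ?eqxx.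
  have [s sE] := (@finite_seqP _ _).1 fin.
  exists (undup s); split=> [|a]; first exact: undup_uniq.
  rewrite mem_undup; have -> : (a \in s) = [set` s] a :> Prop by [].
  by rewrite -sE.
move=> /choice[d dP].
pose G n w := \sum_(a <- d n) (P a).[(w - a)^-1].
(* At index 0 there is no earlier level, and [q = 0] will do. Otherwise approximability of [G n.+1]
   at level [n] covers all levels below [n.+1]. *)
have : forall n, exists q, (forall z, U z -> analytic_at q z) /\
    forall m z r, (m < n)%N -> exhaustion_disc U m z r ->
    wiener (fun w => G n w - q w) z r (2^-1 ^+ n).
  case=> [|n].
    by exists (fun=> 0); split=> [z _|//]; exact: analytic_cst.
  have Gn : approximable U n (G n.+1).
    apply: approximable_sum => a /(dP _).2[[_ an] _].
    by apply: approximable_horner; apply: approximable_pole; exact: an.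
  have [|q qU qn] := Gn.2 (2^-1 ^+ n.+1); first by rewrite exprn_gt0 ?invr_gt0.
  exists q; split=> // m z r mn /(exhaustion_discS (ltnSE mn)); exact: qn.
move=> /choice[q qP].
pose T n w := G n w - q n w.
(* The default value 0 is taken where the series diverges, which can only happen off [U]. *)
pose h w := xget 0 [set l | tends (series (T^~ w)) l].
have hE w l : tends (series (T^~ w)) l -> h w = l.
  move=> wl; apply: xget_subset1 => // x y; exact: tends_uniq.
exists h => z Uz.
have [N [r zr]] := exhaustion_disc_exists oU Uz; have [r0 _ _] := zr.
(* The disc has level [N], so the terms of index above [N] are small on it. *)
have Tw j : wiener (T (N.+1 + j)%N) z r (2^-1 ^+ j).
  apply: wiener_le ((qP _).2 N z r _ zr); last by rewrite addSn ltnS leq_addr.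
  by rewrite ler_wiXn2l ?leq_addl//; lra.
have sum2 n : series (fun j => 2^-1 ^+ j : R) n <= 2.
  rewrite (le_trans (geometric_le _ _ _))//; [lra|].
  have -> : 1 - 2^-1 = 2^-1 :> R by lra.
  by rewrite invrK.
have : forall w, exists l, nrm (w - z) <= r ->
    tends (series (fun j => T (N.+1 + j)%N w)) l.
  move=> w; have [wr|_] := leP (nrm (w - z)) r; last by exists 0.
  have [|l lP] := @abs_cvg_series _ (fun j => T (N.+1 + j)%N w) 2; last first.
    by exists l.
  move=> n; apply: le_trans (sum2 n); apply: ler_sum => j _.
  exact: wiener_nrm (Tw j) wr.
move=> /choice[t tP].
have tz : analytic_at t z.
  exact: wiener_analytic r0 (wiener_sum r0 Tw sum2 tP).
have {}hE w : nrm (w - z) <= r -> h w = \sum_(0 <= n < N.+1) T n w + t w.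
  move=> wr; apply: hE => e /(tP w wr)[K KP].
  exists (N.+1 + K)%N => n Nn.
  have NSn : (N.+1 <= n)%N := leq_trans (leq_addr _ _) Nn.
  have Kn : (K <= n - N.+1)%N by rewrite leq_subRL.
  have -> : series (T^~ w) n = \sum_(0 <= j < N.+1) T j w +
      series (fun j => T (N.+1 + j)%N w) (n - N.+1)%N.
    rewrite /series/= (@big_cat_nat _ _ _ N.+1)//=.
    congr (_ + _); rewrite -{1}[N.+1]add0n big_addn.
    by apply: eq_bigr => j _; rewrite addnC.
  by rewrite opprD addrACA subrr add0r; exact: KP.
have off n : z \notin d n -> analytic_at (G n) z.
  move=> zd.
  apply: (@eq_analytic _
    (fun w => \sum_(a <- d n | a \in d n) (P a).[(w - a)^-1])) => [w|].
    by rewrite -big_seq.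
  apply: analytic_sum => a ad; apply: analytic_horner_pole.
  by apply: contraNneq zd => ->.
(* If [P z] is nonzero, [z] is a pole only of the [G n0] of its own level [n0 <= N]; once its
   principal part is removed, the remaining poles lie elsewhere. *)
have PP : analytic_at
    (fun w => \sum_(0 <= n < N.+1) G n w - (P z).[(w - z)^-1]) z.
  have [Pz|Pz] := eqVneq (P z) 0.
    apply: (@eq_analytic _ (fun w => \sum_(0 <= n < N.+1) G n w)) => [w|].
      by rewrite Pz horner0 subr0.
    apply: analytic_sum => n _; apply: off; apply/negP => /(dP _).2[_].
    by rewrite Pz eqxx.
  have zN := exhaustion_disc_center zr.
  have ex_n : exists n, `[< exhaustion U n z >] by exists N; apply/asboolP.
  have [n0 /asboolP zn0 n0_min] := ex_minnP ex_n.
  have n0N : (n0 < N.+1)%N by rewrite ltnS; apply: n0_min; apply/asboolP.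
  have lev0 : level n0 z.
    by split=> // m mn /asboolP /n0_min; rewrite leqNgt mn.
  have zd : z \in d n0 by apply/(dP _).2.
  apply: (@eq_analytic _ (fun w =>
    \sum_(a <- d n0 | a != z) (P a).[(w - a)^-1] +
    \sum_(0 <= n < N.+1 | n != n0) G n w)) => [w|].
    rewrite [in RHS](bigD1_seq n0) ?mem_index_iota ?iota_uniq//=.
    have -> : G n0 w = (P z).[(w - z)^-1] +
        \sum_(a <- d n0 | a != z) (P a).[(w - a)^-1].
      by rewrite /G (bigD1_seq z zd (dP n0).1).
    by ring.
  apply: (analyticD (f := fun w => \sum_(a <- d n0 | a != z) _)
    (g := fun w => \sum_(0 <= n < N.+1 | n != n0) G n w)).
    apply: analytic_sum => a az.
    by apply: analytic_horner_pole; rewrite eq_sym.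
  apply: analytic_sum => n nn0; apply: off.
  apply/negP => /(dP _).2[[zn nlev] _].
  have [h0|h0|h0] := ltngtP n n0; last by rewrite h0 eqxx in nn0.
    exact: lev0.2 h0 zn.
  exact: nlev h0 zn0.
have qz : analytic_at (fun w => \sum_(0 <= n < N.+1) q n w) z.
  by apply: analytic_sum => n _; have [+ _] := qP n; apply.
apply: (analytic_ext _ (analyticD (analyticB PP qz) tz)).
apply/near_nrmP; exists r => // w /hE ->.
by rewrite /T sumrB; ring.
Qed.

End MittagLeffler.

Lemma sum_indicator (V : pzRingType) (I : finType) (j : I) (F : I -> V) :
  \sum_k (Some j == Some k)%:R * F k = F j.
Proof.
rewrite (bigD1 j)//= eqxx mul1r big1 ?addr0// => k kj.
have -> : (Some j == Some k) = false.
  by apply/eqP => -[jk]; rewrite jk eqxx in kj.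
by rewrite mul0r.
Qed.

Section Bezout.
Context {R : realType}.
Local Notation C := R[i].
Implicit Types (f g F : C -> C) (z w a : C).

(** The zeros of [F] mark the possible singularities. Since they are isolated, [f] is changed near
    each of them only at the zero itself, to the value of its local extension. *)
Lemma removable_singularities (U : set C) F f :
  (forall z, U z -> \forall w \near z, w != z -> F w != 0) ->
  (forall z, U z -> F z != 0 -> analytic_at f z) ->
  (forall z, U z -> F z = 0 -> exists2 g, analytic_at g z &
    \forall w \near z, w != z -> f w = g w) ->
  exists2 g, (forall z, U z -> analytic_at g z) &
    forall z, F z != 0 -> g z = f z.
Proof.
move=> FU fU f0.
have /choice[k kP] : forall z, exists g, U z -> F z = 0 -> analytic_at g z /\
    \forall w \near z, w != z -> f w = g w.
  move=> z; have [[Uz Fz]|nUz] := pselect (U z /\ F z = 0).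
    by have [g gz fg] := f0 z Uz Fz; exists g.
  by exists f => Uz Fz; case: nUz.
exists (fun w => if F w == 0 then k w w else f w) => [z Uz|z /negPf ->//].
have [Fz|Fz] := eqVneq (F z) 0.
  have [kz fk] := kP z Uz Fz.
  apply: (analytic_ext _ kz); apply: filterS2 (FU z Uz) fk => w Fw fw.
  have [->|wz] := eqVneq w z; first by rewrite Fz eqxx.
  by rewrite (negPf (Fw wz)) fw.
apply: (analytic_ext _ (fU z Uz Fz)); apply: filterS (FU z Uz) => w Fw.
have [->|wz] := eqVneq w z; first by rewrite (negPf Fz).
by rewrite (negPf (Fw wz)).
Qed.

Section Family.
Variables (U : set C) (I : finType) (f : I -> C -> C).
Hypothesis oU : open U.
Hypothesis fU : forall i z, U z -> analytic_at (f i) z.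

Definition null_germ z i := `[< \forall w \near z, f i w = 0 >].

Definition first_nonnull z := [pick i | ~~ null_germ z i].

(** A single [f i] may vanish identically on some component of [U]; switching to the first index
    with nonzero germ avoids this. *)
Definition nonnull_fun z := \sum_i (first_nonnull z == Some i)%:R * f i z.

(** A zero germ stays zero at nearby points and a nonzero germ has isolated zeros, so the set of
    null indices is locally constant. *)
Lemma first_nonnull_near z : U z ->
  \forall w \near z, first_nonnull w = first_nonnull z.
Proof.
move=> Uz.
have : \forall w \near z, forall i, null_germ w i = null_germ z i.
  apply: (@filter_forall _ _ (fun i w => null_germ w i = null_germ z i)
    _ (nbhs_filter z)) => i.
  have [iz|/asboolPn iz] := boolP (null_germ z i).
    by move: iz => /asboolP/near_join; apply: filterS => w iw; apply/asboolP.
  apply: filterS (analytic_isolated_zeros (fU i Uz) iz) => w fw.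
  apply/asboolPn; have [->//|/fw/eqP fw0] := eqVneq w z.
  by move/nbhs_singleton.
by apply: filterS => w wz; apply: eq_pick => i; rewrite wz.
Qed.

Lemma analytic_first_nonnull z i : U z ->
  analytic_at (fun w => (first_nonnull w == Some i)%:R) z.
Proof.
move=> Uz; apply: (analytic_ext _ (analytic_cst
  (first_nonnull z == Some i)%:R z)).
by apply: filterS (first_nonnull_near Uz) => w ->.
Qed.

Lemma analytic_nonnull_fun z : U z -> analytic_at nonnull_fun z.
Proof.
move=> Uz; apply: analytic_sum => i _.
exact: (analyticM (analytic_first_nonnull i Uz) (fU i Uz)).
Qed.

Hypothesis f_neq0 : forall z, U z -> exists i, f i z != 0.

(** Since some [f i] is nonzero at [z], an index [j] is picked, and it is the same at nearby points;
    there the function coincides with [f j], whose germ is nonzero. *)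
Lemma nonnull_fun_isolated_zeros z : U z ->
  \forall w \near z, w != z -> nonnull_fun w != 0.
Proof.
move=> Uz; have [i fz] := f_neq0 Uz.
have := erefl (first_nonnull z); rewrite {2}/first_nonnull; case: pickP => [j|].
  move=> /asboolPn jz zj.
  apply: filterS2 (first_nonnull_near Uz)
    (analytic_isolated_zeros (fU j Uz) jz) => w wj fw /fw.
  suff -> : nonnull_fun w = f j w by [].
  by rewrite /nonnull_fun wj zj sum_indicator.
move=> /(_ i)/negbT; rewrite negbK => /asboolP/nbhs_singleton fz0.
by rewrite fz0 eqxx in fz.
Qed.

(* If F = nonnull_fun, the h_i have the principal parts of 1 / (F f_i), each
   zero of F being charged to one index i with f_i nonzero there; then
   u = 1 / F - sum f_i h_i and the v_i = F h_i have removable singularities,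
   and u F + sum v_i f_i = 1. *)
Lemma analytic_bezout : exists g : I -> C -> C,
  (forall i z, U z -> analytic_at (g i) z) /\
  forall z, U z -> \sum_i g i z * f i z = 1.
Proof.
pose F := nonnull_fun; have FU := nonnull_fun_isolated_zeros.
have : forall z, exists P : I -> {poly C},
    (U z -> F z = 0 -> exists i (p : {poly C}) rho,
      [/\ f i z != 0, P = (fun k => if k == i then p else 0),
        analytic_at rho z & \forall w \near z, w != z ->
        (F w * f i w)^-1 = p.[(w - z)^-1] + rho w]) /\
    (F z != 0 -> P = fun=> 0).
  move=> z; have [[Uz Fz]|nUz] := pselect (U z /\ F z = 0); last first.
    by exists (fun=> 0); split=> // Uz Fz; case: nUz.
  have [i fz] := f_neq0 Uz.
  have := analytic_zeros (analytic_nonnull_fun Uz).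
  (* A zero germ of [F] is excluded: its zeros are isolated, and punctured neighbourhoods are
     nonempty. *)
  case=> [F0|[m [k [kz kz0 FE]]]].
    have : \forall w \near z, w != z -> False.
      apply: filterS2 F0 (FU z Uz) => w Fw /[swap] wz /(_ wz).
      by rewrite Fw eqxx.
    move=> /near_nrmP[r r0 /(_ (z + r%:C))].
    rewrite addrC addKr nrm_real ?(ltW r0)// lexx => /(_ isT) [].
    by rewrite -subr_eq0 addrC addKr -nrm_gt0 nrm_real// ltW.
  have kf0 : k z * f i z != 0 by rewrite mulf_neq0.
  (* With [F w = (w - z) ^+ m * k w], the function [1 / (F f_i)] is [(k f_i)^-1 / (w - z) ^+ m]. *)
  have [p [rho [rz rE]]] := analytic_laurent m
    (analyticV (analyticM kz (fU i Uz)) kf0).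
  exists (fun j => if j == i then p else 0); split; last by rewrite Fz eqxx.
  move=> _ _; exists i, p, rho; split=> //; apply: near_all => w wz.
  by rewrite -rE// [F w]FE -mulrA invfM mulrC.
move=> /choice[P PP].
have /choice[h hP] : forall i, exists h : C -> C, forall z, U z ->
    analytic_at (fun w => h w - (P z i).[(w - z)^-1]) z.
  move=> i; apply: mittag_leffler => // z Uz.
  by apply: filterS (FU z Uz) => w Fw /Fw /(PP w).2 ->.
have hU i z : U z -> F z != 0 -> analytic_at (h i) z.
  move=> Uz /(PP z).2 Pz; apply: eq_analytic (hP i z Uz) => w.
  by rewrite Pz horner0 subr0.
have FA z : U z -> analytic_at F z by exact: analytic_nonnull_fun.
have /choice[v vP] : forall i, exists v : C -> C,
    (forall z, U z -> analytic_at v z) /\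
    forall z, F z != 0 -> v z = F z * h i z.
  move=> k; have [//|z Uz Fz|z Uz Fz|v vU vE] :=
    @removable_singularities U F (fun w => F w * h k w).
  - exact: (analyticM (FA z Uz) (hU k z Uz Fz)).
  - have [i [p [rho [fz Pz rz rE]]]] := (PP z).1 Uz Fz.
    have FhP := analyticM (FA z Uz) (hP k z Uz).
    have [ki|ki] := eqVneq k i; last first.
      exists (fun w => F w * (h k w - (P z k).[(w - z)^-1])) => //.
      by apply: near_all => w _; rewrite Pz (negPf ki) horner0 subr0.
    (* Near [z], [F] times the principal part is [1 / f_i - F rho], which extends analytically. *)
    exists (fun w => F w * (h k w - (P z k).[(w - z)^-1]) +
        ((f i w)^-1 - F w * rho w)).
      exact: (analyticD FhP (analyticB (analyticV (fU i Uz) fz)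
        (analyticM (FA z Uz) rz))).
    apply: filterS2 rE (FU z Uz) => w rE Fw wz; have {}Fw := Fw wz.
    rewrite Pz ki eqxx.
    have -> : (f i w)^-1 = F w * (F w * f i w)^-1 by rewrite invfM mulVKf.
    by rewrite rE//; ring.
  by exists v.
have [//|z Uz Fz|z Uz Fz|u uU uE] :=
    @removable_singularities U F (fun w => (F w)^-1 - \sum_k f k w * h k w).
- apply: (analyticB (analyticV (FA z Uz) Fz)); apply: analytic_sum => k _.
  exact: (analyticM (fU k Uz) (hU k z Uz Fz)).
- have [i [p [rho [fz Pz rz rE]]]] := (PP z).1 Uz Fz.
  (* Near [z], [1 / F = f_i / (F f_i)], so its pole cancels against [f_i] times the principal part,
     leaving [f_i rho]. *)
  exists (fun w => f i w * rho w -
      \sum_k f k w * (h k w - (P z k).[(w - z)^-1])).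
    apply: (analyticB (analyticM (fU i Uz) rz)); apply: analytic_sum => k _.
    exact: (analyticM (fU k Uz) (hP k z Uz)).
  apply: filterS2 rE (analytic_neq0 (fU i Uz) fz) => w rE fw wz.
  have -> : (F w)^-1 = f i w * (F w * f i w)^-1.
    by rewrite invfM mulrCA mulfV// mulr1.
  have E : \sum_k f k w * (P z k).[(w - z)^-1] = f i w * p.[(w - z)^-1].
    rewrite (bigD1 i)//= big1 => [|k ki]; first by rewrite Pz eqxx addr0.
    by rewrite Pz (negPf ki) horner0 mulr0.
  rewrite rE//; under [in RHS]eq_bigr do rewrite mulrBr.
  by rewrite sumrB E; ring.
(* [F] is the sum of the [f i] weighted by the indicators, so [u F] adds [u] times the indicator to
   each coefficient. *)
pose g i w := v i w + u w * (first_nonnull w == Some i)%:R.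
have gU i z : U z -> analytic_at (g i) z.
  move=> Uz; apply: analyticD; first exact: (vP i).1.
  exact: (analyticM (uU z Uz) (analytic_first_nonnull i Uz)).
have gE w : F w != 0 -> \sum_i g i w * f i w = 1.
  move=> Fw; under eq_bigr do rewrite mulrDl -mulrA.
  rewrite big_split/= -mulr_sumr -[X in _ * X]/(F w) uE// mulrBl mulVf//.
  under eq_bigr do rewrite (vP _).2// -mulrA.
  rewrite -mulr_sumr; under eq_bigr do rewrite mulrC.
  by rewrite mulrC addrC subrK.
exists g; split=> // z Uz; apply/eqP; rewrite -subr_eq0; apply/eqP.
(* The identity extends to the zeros of [F] by continuity. *)
apply: (@analytic_identity _ (fun w => \sum_i g i w * f i w - 1)).
  apply: (analyticB _ (analytic_cst 1 z)); apply: analytic_sum => i _.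
  exact: (analyticM (gU i z Uz) (fU i Uz)).
by apply: filterS (FU z Uz) => w Fw /Fw/gE ->; rewrite subrr.
Qed.

End Family.
End Bezout.

(** * Matrices over the ring of analytic functions *)

Section AnalyticMatrix.
Context {R : realType} {Omega : set R[i]}.
Local Notation C := R[i].
Local Notation A := (analytic_ring Omega).
Local Notation AF := (analytic_fun Omega).

(** Evaluating a function rather than a germ is a ring morphism at every [z]; for [analytic_eval],
    which goes through [repr], compatibility with products is then obtained at points of [Omega]. *)
Definition fun_eval (z : C) (f : AF) : C := f z.

Lemma fun_eval_zmod_morphism z : zmod_morphism (fun_eval z).
Proof. by []. Qed.

Lemma fun_eval_monoid_morphism z : monoid_morphism (fun_eval z).
Proof. by []. Qed.

HB.instance Definition _ z := GRing.isZmodMorphism.Build AF C (fun_eval z)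
  (fun_eval_zmod_morphism z).
HB.instance Definition _ z := GRing.isMonoidMorphism.Build AF C (fun_eval z)
  (fun_eval_monoid_morphism z).

Definition repr_mx m n (Q : 'M[A]_(m, n)) : 'M[AF]_(m, n) := map_mx repr Q.

Lemma germ_repr_mx m n (Q : 'M[A]_(m, n)) :
  map_mx (@analytic_germ R Omega) (repr_mx Q) = Q.
Proof. by apply/matrixP => i j; rewrite !mxE analytic_germK. Qed.

Lemma analytic_eval_repr_mx m n (Q : 'M[A]_(m, n)) z :
  map_mx (analytic_eval z) Q = map_mx (fun_eval z) (repr_mx Q).
Proof. by apply/matrixP => i j; rewrite !mxE. Qed.

Lemma eval_map_germ m n (Q : 'M[AF]_(m, n)) z : Omega z ->
  map_mx (analytic_eval z) (map_mx (@analytic_germ R Omega) Q) =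
  map_mx (fun_eval z) Q.
Proof. by move=> Oz; apply/matrixP => i j; rewrite !mxE analytic_evalE. Qed.

Lemma analytic_eval_mulmx m n p (P : 'M[A]_(m, n)) (Q : 'M[A]_(n, p)) z :
  Omega z -> map_mx (analytic_eval z) (P *m Q) =
  map_mx (analytic_eval z) P *m map_mx (analytic_eval z) Q.
Proof.
move=> Oz; rewrite -{1}[P]germ_repr_mx -{1}[Q]germ_repr_mx -map_mxM.
by rewrite eval_map_germ// map_mxM -!analytic_eval_repr_mx.
Qed.

Lemma analytic_eval_mx1 n z : Omega z ->
  map_mx (analytic_eval z) (1%:M : 'M[A]_n) = 1%:M.
Proof.
move=> Oz; rewrite -(map_mx1 (@analytic_germ R Omega)) eval_map_germ//.
exact: map_mx1.
Qed.

Lemma left_invertible_rank n p (Q : 'M[A]_(n, p)) z : Omega z ->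
  left_invertible Q -> \rank (map_mx (analytic_eval z) Q) = p.
Proof.
move=> Oz [L LQ]; apply/eqP; rewrite eqn_leq rank_leq_col/=.
rewrite -{1}(mxrank1 C p) -(analytic_eval_mx1 p Oz) -LQ analytic_eval_mulmx//.
exact: mxrankM_maxr.
Qed.


Lemma rank_left_invertible n p (Q : 'M[A]_(n, p)) :
  (forall z, Omega z -> \rank (map_mx (analytic_eval z) Q) = p) ->
  left_invertible Q.
Proof.
move=> rkQ; pose Qr := repr_mx Q.
(* All maps [s] are allowed as row selections; a repeated row only gives a zero minor. *)
pose minor (s : {ffun 'I_p -> 'I_n}) (z : C) : C :=
  \det (rowsub s (map_mx (fun_eval z) Qr)).
(* Each entry has a representative analytic near [Omega]; taking the interior makes their common
   domain open. *)
pose V : set C := [set z | forall ij : 'I_n * 'I_p,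
  analytic_at (Qr ij.1 ij.2) z]^°.
have minorV s z : V z -> analytic_at (minor s) z.
  move=> /interior_subset Vz; apply: analytic_sum => t _.
  apply: (analyticM (analytic_cst _ _)).
  apply: analytic_prod => i.
  have := Vz (s i, t i); apply: eq_analytic => w.
  by rewrite !mxE.
have OV : Omega `<=` V.
  move=> z Oz; apply: (@filter_forall _ _
    (fun ij : 'I_n * 'I_p => analytic_at (Qr ij.1 ij.2)) _ (nbhs_filter z)).
  by move=> [i j]; have /asboolP := valP (Qr i j); apply.
pose U : set C := V `&` [set z | exists s, minor s z != 0].
have oU : open U.
  rewrite openE => z [Vz [s sz]].
  have Vn : \forall w \near z, V w.
    exact: open_nbhs_nbhs (conj (@open_interior _ _) Vz).
  apply: filterS2 Vn (analytic_neq0 (minorV s z Vz) sz) => w Vw sw.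
  by split=> //; exists s.
have OU : Omega `<=` U.
  move=> z Oz; split; first exact: OV.
  have fullQ : row_full (map_mx (analytic_eval z) Q) by apply/eqP; exact: rkQ.
  exists (fullrankfun fullQ); rewrite /minor -analytic_eval_repr_mx.
  by have := fullrowsub_full fullQ; rewrite row_full_unit unitmxE unitfE.
have [g [gU gE]] := @analytic_bezout _ U _ minor oU
  (fun s z Uz => minorV s z Uz.1) (fun z Uz => Uz.2).
have gO s : g s \in analytic_near Omega.
  by apply/analytic_nearP; exists U; split=> // z; exact: gU.
pose G s : AF := AnalyticFun (gO s).
have GE : \sum_s analytic_germ (G s) * \det (rowsub s Q) = 1.
  rewrite -[Q]germ_repr_mx -/Qr.
  under eq_bigr do rewrite -map_mxsub det_map_mx -rmorphM.
  rewrite -rmorph_sum; apply/analytic_germ_eq/set_nbhsP.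
  exists U; split=> // z Uz.
  rewrite /= -[LHS]/(fun_eval z _) rmorph_sum -[RHS](gE z Uz).
  by apply: eq_bigr => s _; rewrite rmorphM -det_map_mx map_mxsub.
exists (\sum_s analytic_germ (G s) *: (\adj (rowsub s Q) *m rowsub s 1%:M)).
rewrite mulmx_suml -[in RHS]GE raddf_sum.
apply: eq_bigr => s _; rewrite -scalemxAl -mulmxA -rowsubE mul_adj_mx.
by rewrite scale_scalar_mx.
Qed.

End AnalyticMatrix.

(** * Left inverses over a commutative ring, and the equivalence *)

Lemma left_invertible_independent (S : comPzRingType) n p (Q : 'M[S]_(n, p)) :
  left_invertible Q -> linearly_independent (fun j => col j Q).
Proof.
move=> [L LQ] c c0 i.
have Qc : Q *m (\col_j c j) = 0.
  rewrite -[RHS]c0; apply/matrixP => k l; rewrite mxE summxE.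
  by apply: eq_bigr => j _; rewrite !mxE mulrC.
have := congr1 (fun M : 'cV_p => M i 0) (congr1 (mulmx L) Qc).
by rewrite mulmxA LQ mul1mx mulmx0 !mxE.
Qed.

(** [invertible_basis] fixes the columns up to a permutation; permuting the rows of the left inverse
    compensates for it. *)
Lemma left_invertible_col_perm (S : comPzRingType) n p (P Q : 'M[S]_(n, p))
  (s : 'S_p) : (forall j, col j P = col (s j) Q) ->
  left_invertible P -> left_invertible Q.
Proof.
move=> PQ [L LP]; exists (row_perm s^-1 L).
have -> : Q = col_perm s^-1 P.
  apply/matrixP => i j; rewrite mxE.
  have /matrixP/(_ i 0) := PQ (s^-1 j)%g.
  by rewrite !mxE permKV.
rewrite row_permE col_permE !mulmxA -(mulmxA _ L) LP mulmx1.
by rewrite -perm_mxM ?invgK ?mulgV ?mulVg perm_mx1.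
Qed.

Theorem proposition4p2 (R : realType) (Omega : set R[i])
    (Omega_neq0 : Omega !=set0) (Omega_connected : connected Omega)
    (Omega_compact_or_open : compact Omega \/ open Omega)
    (n p : nat) (Q : 'M[analytic_ring Omega]_(n, p)) :
  invertible_basis (span_of (fun j => col j Q)) (fun j => col j Q) <->
  (forall z, Omega z -> \rank (map_mx (analytic_eval z) Q) = p).
Proof.
split=> [[_ [P [[s PQ] linvP]]] z Oz|rkQ].
  exact: left_invertible_rank Oz (left_invertible_col_perm PQ linvP).
have linvQ := rank_left_invertible rkQ.
split; first by split=> //; exact: left_invertible_independent.
exists Q; split=> //; exists (1%g : 'S_p) => j.
by rewrite perm1.
Qed.
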